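(* Let $\mathcal{G}$ be an agreeable subgroup of $\mathrm{GL}_2(\widehat{\mathbb{Z}})$ and let $N$ be the least common multiple of the levels of $\mathcal{G}$ and of $[\mathcal{G},\mathcal{G}]$. Then there is a computable finite set $\mathcal{S}_{\mathcal{G}}$ of open subgroups of $\mathcal{G}$ such that: (1) for every $G\in\mathcal{S}_{\mathcal{G}}$, $[\mathcal{G},\mathcal{G}]\subseteq G\cap\mathrm{SL}_2(\widehat{\mathbb{Z}})\subseteq\mathcal{G}\cap\mathrm{SL}_2(\widehat{\mathbb{Z}})$; (2) for every $G\in\mathcal{S}_{\mathcal{G}}$, the level of $G$ divides $2^kN$ for some $k\ge0$; (3) for every $G\in\mathcal{S}_{\mathcal{G}}$, the index $[\widehat{\mathbb{Z}}^\times:\det(G)]$ is a power of $2$; (4) for every group $W$ with $[\mathcal{G},\mathcal{G}]\subseteq W\subseteq\mathcal{G}\cap\mathrm{SL}_2(\widehat{\mathbb{Z}})$, there is a unique $G\in\mathcal{S}_{\mathcal{G}}$ with $G\cap\mathrm{SL}_2(\widehat{\mathbb{Z}})=W$.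
   Context: $[G,G]$ denotes the closed subgroup generated by commutators; for open $\mathcal{G}$ it is open in $\mathrm{SL}_2(\widehat{\mathbb{Z}})$. The level of an open subgroup of $\mathrm{GL}_2(\widehat{\mathbb{Z}})$ (resp. $\mathrm{SL}_2(\widehat{\mathbb{Z}})$) is the smallest $n\ge1$ such that it contains the kernel of reduction modulo $n$. A subgroup $\mathcal{G}\subseteq\mathrm{GL}_2(\widehat{\mathbb{Z}})$ is agreeable if it is open, contains all scalar matrices $\widehat{\mathbb{Z}}^\times I$, and every prime dividing the level of $\mathcal{G}$ divides the level of $[\mathcal{G},\mathcal{G}]$. *)

(* Defs.v *)
From HB Require Import structures.
From mathcomp Require Import all_boot all_order all_algebra.
From mathcomp Require Import all_classical all_reals all_analysis.

Set Implicit Arguments.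
Unset Strict Implicit.
Unset Printing Implicit Defensive.

Import GRing.Theory.
Local Open Scope classical_set_scope.
Local Open Scope ring_scope.

(* The inverse limit of the rings Z/nZ.  For n > 0 the component [zcomp x n]
   is the residue of x modulo n, since 'I_(n.-1.+1) is then 'I_n; the component
   at 0 lives in the trivial group 'I_1 and carries no information. *)
Record Zhat := MkZhat {
  zcomp : forall n : nat, 'I_(n.-1.+1);
  zcomp_compat : forall m n : nat,
    (0 < n)%N -> (m %| n)%N -> inZp (zcomp n) = zcomp m
}.

HB.instance Definition _ := gen_eqMixin Zhat.
HB.instance Definition _ := gen_choiceMixin Zhat.

Lemma zhatP (x y : Zhat) : (forall n, zcomp x n = zcomp y n) -> x = y.
Proof.
case: x y => [f Hf] [g Hg] /= fg.
have {}fg : f = g by apply: functional_extensionality_dep.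
by case: _ / fg Hg => Hg; congr MkZhat; apply: Prop_irrelevance.
Qed.

Lemma zmod_dvd (m n : nat) :
  (0 < n)%N -> (m %| n)%N -> (m.-1.+1 %| n.-1.+1)%N.
Proof. by case: m n => [|m] [|n] //= _; rewrite dvd1n. Qed.

Lemma zhat_cst_compat (k m n : nat) : (0 < n)%N -> (m %| n)%N ->
  inZp (inZp k : 'I_(n.-1.+1)) = inZp k :> 'I_(m.-1.+1).
Proof.
by move=> n0 mn; apply: val_inj => /=; rewrite modn_dvdm //; apply: zmod_dvd.
Qed.

Lemma zhat_add_compat (x y : Zhat) (m n : nat) : (0 < n)%N -> (m %| n)%N ->
  inZp (Zp_add (zcomp x n) (zcomp y n)) = Zp_add (zcomp x m) (zcomp y m).
Proof.
move=> n0 mn; rewrite -(zcomp_compat x n0 mn) -(zcomp_compat y n0 mn).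
by apply: val_inj; rewrite /= modn_dvdm ?modnDm //; apply: zmod_dvd.
Qed.

Lemma zhat_opp_compat (x : Zhat) (m n : nat) : (0 < n)%N -> (m %| n)%N ->
  inZp (Zp_opp (zcomp x n)) = Zp_opp (zcomp x m).
Proof.
move=> n0 mn; rewrite -(zcomp_compat x n0 mn).
apply: val_inj; rewrite /= modn_dvdm; last exact: zmod_dvd.
have dvd := zmod_dvd n0 mn; set a : nat := zcomp x n.
have an : (a <= n.-1.+1)%N by rewrite ltnW // ltn_ord.
apply/eqP; rewrite -(eqn_modDr (a %% m.-1.+1)) subnK; last first.
  by rewrite ltnW // ltn_pmod.
by rewrite modnDmr subnK // modnn; move: dvd; rewrite /dvdn => /eqP ->.
Qed.

Lemma zhat_mul_compat (x y : Zhat) (m n : nat) : (0 < n)%N -> (m %| n)%N ->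
  inZp (Zp_mul (zcomp x n) (zcomp y n)) = Zp_mul (zcomp x m) (zcomp y m).
Proof.
move=> n0 mn; rewrite -(zcomp_compat x n0 mn) -(zcomp_compat y n0 mn).
by apply: val_inj; rewrite /= modn_dvdm ?modnMm //; apply: zmod_dvd.
Qed.

Definition zhat_cst (k : nat) : Zhat := MkZhat (@zhat_cst_compat k).
Definition zhat_add (x y : Zhat) : Zhat := MkZhat (@zhat_add_compat x y).
Definition zhat_opp (x : Zhat) : Zhat := MkZhat (@zhat_opp_compat x).
Definition zhat_mul (x y : Zhat) : Zhat := MkZhat (@zhat_mul_compat x y).

Lemma zhat_addA : associative zhat_add.
Proof. by move=> x y z; apply: zhatP => n /=; rewrite Zp_addA. Qed.
Lemma zhat_addC : commutative zhat_add.
Proof. by move=> x y; apply: zhatP => n /=; rewrite Zp_addC. Qed.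
Lemma zhat_add0 : left_id (zhat_cst 0) zhat_add.
Proof.
by move=> x; apply: zhatP => n; apply: val_inj; rewrite /= mod0n modn_small // add0n ltn_ord.
Qed.
Lemma zhat_addN : left_inverse (zhat_cst 0) zhat_opp zhat_add.
Proof.
move=> x; apply: zhatP => n; apply: val_inj.
by rewrite /= modnDml subnK ?modnn ?mod0n // ltnW ?ltn_ord.
Qed.

HB.instance Definition _ :=
  GRing.isZmodule.Build Zhat zhat_addA zhat_addC zhat_add0 zhat_addN.

Lemma zhat_mulA : associative zhat_mul.
Proof. by move=> x y z; apply: zhatP => n; apply: Zp_mulA. Qed.
Lemma zhat_mulC : commutative zhat_mul.
Proof. by move=> x y; apply: zhatP => n; apply: Zp_mulC. Qed.
Lemma zhat_mul1 : left_id (zhat_cst 1) zhat_mul.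
Proof. by move=> x; apply: zhatP => n; apply: Zp_mul1z. Qed.
Lemma zhat_mulD : left_distributive zhat_mul zhat_add.
Proof. by move=> x y z; apply: zhatP => n; apply: Zp_mul_addl. Qed.
Lemma zhat_1neq0 : zhat_cst 1 != 0 :> Zhat.
Proof. by apply/eqP => /(congr1 (fun x => val (zcomp x 2))). Qed.

HB.instance Definition _ := GRing.Zmodule_isComNzRing.Build Zhat
  zhat_mulA zhat_mulC zhat_mul1 zhat_mulD zhat_1neq0.

Definition zhat_unit : {pred Zhat} := fun x => `[< exists y, y * x = 1 >].
Definition zhat_inv (x : Zhat) : Zhat := xget x [set y | y * x = 1].

Lemma zhat_mulVx : {in zhat_unit, left_inverse 1 zhat_inv *%R}.
Proof.
by move=> x /asboolP [y yx]; rewrite /zhat_inv; case: xgetP => [z _|/(_ y)].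
Qed.
Lemma zhat_unitPl (x y : Zhat) : y * x = 1 -> zhat_unit x.
Proof. by move=> yx; apply/asboolP; exists y. Qed.
Lemma zhat_inv_out : {in [predC zhat_unit], zhat_inv =1 id}.
Proof.
move=> x nux; rewrite /zhat_inv; case: xgetP => // z _ zx.
by move: nux; rewrite inE /= => /negP []; apply: zhat_unitPl zx.
Qed.

HB.instance Definition _ := GRing.ComNzRing_hasMulInverse.Build Zhat
  zhat_mulVx zhat_unitPl zhat_inv_out.

Record GL2Zhat := MkGL2 {
  mx_of :> 'M[Zhat]_2;
  mx_unit : mx_of \in unitmx
}.

HB.instance Definition _ := [isSub for mx_of].
HB.instance Definition _ := [Choice of GL2Zhat by <:].

Lemma gl2_mul_unit (A B : GL2Zhat) : A *m B \in unitmx.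
Proof. by rewrite unitmx_mul !mx_unit. Qed.
Lemma gl2_inv_unit (A : GL2Zhat) : invmx A \in unitmx.
Proof. by rewrite unitmx_inv mx_unit. Qed.

Definition gl2_one : GL2Zhat := MkGL2 (unitmx1 Zhat 2).
Definition gl2_mul (A B : GL2Zhat) : GL2Zhat := MkGL2 (gl2_mul_unit A B).
Definition gl2_inv (A : GL2Zhat) : GL2Zhat := MkGL2 (gl2_inv_unit A).

Lemma gl2_mulA : associative gl2_mul.
Proof. by move=> A B C; apply: val_inj; apply: mulmxA. Qed.
Lemma gl2_mul1 : left_id gl2_one gl2_mul.
Proof. by move=> A; apply: val_inj; apply: mul1mx. Qed.
Lemma gl2_mulx1 : right_id gl2_one gl2_mul.
Proof. by move=> A; apply: val_inj; apply: mulmx1. Qed.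
Lemma gl2_mulV : left_inverse gl2_one gl2_inv gl2_mul.
Proof. by move=> A; apply: val_inj; apply: mulVmx; apply: mx_unit. Qed.
Lemma gl2_mulxV : right_inverse gl2_one gl2_inv gl2_mul.
Proof. by move=> A; apply: val_inj; apply: mulmxV; apply: mx_unit. Qed.

HB.instance Definition _ := isGroup.Build GL2Zhat
  gl2_mulA gl2_mul1 gl2_mulx1 gl2_mulV gl2_mulxV.

Definition mx_eqmod (n : nat) (A B : 'M[Zhat]_2) : Prop :=
  forall i j, zcomp (A i j) n = zcomp (B i j) n.

(* The profinite topology: the residue classes modulo n > 0 form a basis. *)
Definition gl2_open (U : set GL2Zhat) : Prop :=
  forall A, U A ->
    exists2 n : nat, (0 < n)%N & forall B : GL2Zhat, mx_eqmod n A B -> U B.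

Lemma gl2_openT : gl2_open setT.
Proof. by move=> A _; exists 1%N. Qed.
Lemma gl2_openI : setI_closed gl2_open.
Proof.
move=> U V oU oV A [/oU [m m0 Um] /oV [n n0 Vn]].
exists (m * n)%N; first by rewrite muln_gt0 m0.
have mn0 : (0 < m * n)%N by rewrite muln_gt0 m0.
move=> B AB; split; [apply: Um|apply: Vn] => i j.
  by rewrite -!(zcomp_compat _ mn0 (dvdn_mulr n (dvdnn m))) AB.
by rewrite -!(zcomp_compat _ mn0 (dvdn_mull m (dvdnn n))) AB.
Qed.
Lemma gl2_open_bigU (I : Type) (f : I -> set GL2Zhat) :
  (forall i, gl2_open (f i)) -> gl2_open (\bigcup_i f i).
Proof.
move=> of_ A [i _ /of_ [n n0 fn]].
by exists n => // B /fn fB; exists i.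
Qed.

HB.instance Definition _ := isOpenTopological.Build GL2Zhat
  gl2_openT gl2_openI gl2_open_bigU.

Definition subgroup_set (T : groupType) (H : set T) : Prop :=
  [/\ H 1%g, forall x y, H x -> H y -> H (x * y)%g & forall x, H x -> H x^-1%g].

Definition SL2Zhat : set GL2Zhat := [set A | \det A = 1].

Definition ker_mod (n : nat) : set GL2Zhat := [set A | mx_eqmod n A 1%:M].

Definition closed_commutator (G : set GL2Zhat) : set GL2Zhat :=
  smallest (fun H : set GL2Zhat => subgroup_set H /\ closed H)
    [set [~ a, b]%g | a in G & b in G].

(* The level of H as a subgroup of K, with K either setT (for GL_2) or
   SL2Zhat; it is 0 when H contains no K `&` ker_mod n with n > 0. *)
Definition level (K H : set GL2Zhat) : nat :=
  xget 0%N [set n : nat | [/\ (0 < n)%N, K `&` ker_mod n `<=` H &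
    forall m : nat, (0 < m)%N -> K `&` ker_mod m `<=` H -> (n <= m)%N]].

Definition agreeable (G : set GL2Zhat) : Prop :=
  [/\ subgroup_set G, open G,
      forall (A : GL2Zhat) (u : Zhat), mx_of A = u%:M -> G A &
      forall p : nat, prime p -> (p %| level setT G)%N ->
        (p %| level SL2Zhat (closed_commutator G))%N].

Definition det_image (G : set GL2Zhat) : set Zhat := [set \det A | A in G].

Definition unit_cosets (D : set Zhat) : set (set Zhat) :=
  [set [set u * d | d in D] | u in [set u : Zhat | u \is a GRing.unit]].

(* Kleene's mu-recursive functions. *)
Inductive recfun : nat -> Type :=
| RecZero n : recfun n
| RecSucc : recfun 1
| RecProj n : 'I_n -> recfun n
| RecComp n m : recfun m -> ('I_m -> recfun n) -> recfun n
| RecPrim n : recfun n -> recfun n.+2 -> recfun n.+1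
| RecMin n : recfun n.+1 -> recfun n.

(* [rec_eval f v y]: f converges on the arguments v, with value y; it is only
   meant for [size v] equal to the arity of f.  Primitive recursion is on the
   first argument: f (0, v) = g v and f (k + 1, v) = h (k, f (k, v), v). *)
Fixpoint rec_eval (n : nat) (f : recfun n) : seq nat -> nat -> Prop :=
  match f with
  | RecZero _ => fun _ y => y = 0%N
  | RecSucc => fun v y => y = (nth 0%N v 0%N).+1
  | RecProj _ i => fun v y => y = nth 0%N v i
  | RecComp _ m g hs => fun v y =>
      exists2 w : m.-tuple nat,
        forall i, rec_eval (hs i) v (tnth w i) & rec_eval g w y
  | RecPrim _ g h => fun v =>
      (fix iter_h (k : nat) : nat -> Prop :=
         match k with
         | 0%N => rec_eval g (behead v)
         | k'.+1 => fun y =>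
             exists2 z, iter_h k' z & rec_eval h [:: k', z & behead v] y
         end) (nth 0%N v 0%N)
  | RecMin _ g => fun v y =>
      rec_eval g (y :: v) 0%N /\
      forall k, (k < y)%N -> exists z, rec_eval g (k :: v) z.+1
  end.

(* A finite description of an open subgroup: a modulus n > 0 and the list of
   its elements modulo n, a matrix being listed as its entries in row order. *)
Definition presentation : Type := (nat * seq (nat * nat * nat * nat))%type.

Definition nat_mx (e : nat * nat * nat * nat) : 'M[Zhat]_2 :=
  let: (a, b, c, d) := e in
  \matrix_(i < 2, j < 2)
    (if i == 0 then if j == 0 then a else b
     else if j == 0 then c else d)%:R.

Definition presents (P : presentation) (G : set GL2Zhat) : Prop :=
  (0 < P.1)%N /\
  G = [set A | exists2 e, e \in P.2 & mx_eqmod P.1 A (nat_mx e)].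

(* The list Q describes exactly the members of S. *)
Definition presents_all (Q : seq presentation) (S : set (set GL2Zhat)) : Prop :=
  (forall P, P \in Q -> exists2 G, S G & presents P G) /\
  (forall G, S G -> exists2 P, P \in Q & presents P G).

(* [pickle] is the explicit encoding of pairs and lists of natural numbers by
   natural numbers. *)
Definition computes_on (f : recfun 1) (P : presentation)
    (Q : seq presentation) : Prop :=
  rec_eval f [:: pickle P] (pickle Q).

(* Main.v *)
Require Import Defs.
From HB Require Import structures.
From mathcomp Require Import all_boot all_order all_algebra all_fingroup all_solvable.
From mathcomp Require Import all_classical all_reals all_analysis.
From mathcomp Require Import zify ring.

(** Let [N] be the least common multiple of the two levels.  A group [W] between
    [[GG, GG]] and [GG] [&] [SL2] is recovered as the determinant-one part of
      [G_W = { A | A = v ^ (2 ^ N) w mod N, with w in W and v a unit }]: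
    if [det A = 1] then [v ^ (2 ^ (N + 1)) = 1 mod N], and since the 2-part of the
    order of [(Z/N)^*] is less than [2 ^ N] this forces [v ^ (2 ^ N) = 1 mod N], so
    that [A = w mod N].  Scalars lie in [GG], hence so does [G_W]; its determinants
    contain all [2 ^ (N + 1)]-th powers, hence their index is a power of 2.

    If [GG] contains the kernel of reduction modulo [n], the commutators of [GG]
    contain the elementary matrices with off-diagonal entry divisible by [2 n ^ 2],
    and these generate the kernel of [SL2] modulo [L = 4 n ^ 4].  All the data can
    thus be read modulo [L], and the list of the [G_W] is found by an unbounded
    search for a solution of an arithmetic formula with bounded quantifiers. *)

Set Implicit Arguments.
Unset Strict Implicit.
Unset Printing Implicit Defensive.

(** * Recursive functions *)

(** Multiplying [W] by all scalars would spoil its determinant-one part, as [v ^ 2 = 1] has many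
    solutions; taking [2 ^ N]-th powers kills the 2-torsion modulo [N], and only residues modulo [N]
    matter because [W] contains the kernel of SL2 modulo [N]. For the same reason there are finitely
    many [W], and the level of [G_W] divides [N] itself.

    A presentation gives only the modulus [n]: neither [N] nor the closure [[GG, GG]] can be read
    off it. The explicit [L] removes this obstacle. Every subgroup containing the commutators of
    [GG] contains the kernel of SL2 modulo [L], so both levels divide [L], and membership in
    [[GG, GG]] is tested by a bounded quantification over the codes of sets of matrices modulo [L].
    In [L = (2 n ^ 2) ^ 2], one factor [n] places a unitriangular matrix in [GG], the factor [2 n]
    is a multiple of [a - 1] for a suitable diagonal entry [a], and the square comes from writing a
    unit as [1 + m (m z)].

    The formula depends on the presentation alone, so one function serves all [GG]; it suffices that
    the formula is recursive, that it has a solution and that each of its solutions is correct. *)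

(** All arities share the type [seq nat -> nat], so that bodies can be analysed syntactically;
    values on lists of another length are irrelevant. *)
Definition recursive k (F : seq nat -> nat) : Prop :=
  exists f : recfun k, forall v, size v = k -> rec_eval f v (F v).

Lemma eq_recursive k (F G : seq nat -> nat) :
  (forall v, size v = k -> F v = G v) -> recursive k F -> recursive k G.
Proof. by move=> FG [f fE]; exists f => v vk; rewrite -FG //; apply: fE. Qed.

Lemma recursive_proj k i : i < k -> recursive k (fun v => nth 0 v i).
Proof. by move=> ik; exists (RecProj (Ordinal ik)). Qed.

Lemma recursive_comp k m (F : seq nat -> nat) (hs : nat -> seq nat -> nat) :
  recursive m F -> (forall i, i < m -> recursive k (hs i)) ->
  recursive k (fun v => F [seq hs i v | i <- iota 0 m]).
Proof.
move=> [f fE] rhs.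
have /fin_all_exists [h hE] : forall i : 'I_m, recursive k (hs i).
  by move=> i; apply: rhs.
exists (RecComp f h) => v vk.
have sz : size [seq hs i v | i <- iota 0 m] == m by rewrite size_map size_iota.
exists (Tuple sz) => [i|]; last by apply: fE; apply/eqP.
rewrite (tnth_nth 0) /= (nth_map 0) ?size_iota // nth_iota //.
exact: hE.
Qed.

Lemma recursive_comp1 k (f : nat -> nat) F1 :
  recursive 1 (fun v => f (nth 0 v 0)) ->
  recursive k F1 ->
  recursive k (fun v => f (F1 v)).
Proof.
move=> rf r1.
apply: (@recursive_comp k _ _ (nth F1 [:: F1]) rf).
by case=> [|i].
Qed.

Lemma recursive_comp2 k (f : nat -> nat -> nat) F1 F2 :
  recursive 2 (fun v => f (nth 0 v 0) (nth 0 v 1)) ->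
  recursive k F1 -> recursive k F2 ->
  recursive k (fun v => f (F1 v) (F2 v)).
Proof.
move=> rf r1 r2.
apply: (@recursive_comp k _ _ (nth F1 [:: F1; F2]) rf).
by case=> [|[|i]].
Qed.

Lemma recursive_comp3 k (f : nat -> nat -> nat -> nat) F1 F2 F3 :
  recursive 3 (fun v => f (nth 0 v 0) (nth 0 v 1) (nth 0 v 2)) ->
  recursive k F1 -> recursive k F2 -> recursive k F3 ->
  recursive k (fun v => f (F1 v) (F2 v) (F3 v)).
Proof.
move=> rf r1 r2 r3.
apply: (@recursive_comp k _ _ (nth F1 [:: F1; F2; F3]) rf).
by case=> [|[|[|i]]].
Qed.

Lemma recursive_comp4 k (f : nat -> nat -> nat -> nat -> nat) F1 F2 F3 F4 :
  recursive 4 (fun v => f (nth 0 v 0) (nth 0 v 1) (nth 0 v 2) (nth 0 v 3)) ->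
  recursive k F1 -> recursive k F2 -> recursive k F3 -> recursive k F4 ->
  recursive k (fun v => f (F1 v) (F2 v) (F3 v) (F4 v)).
Proof.
move=> rf r1 r2 r3 r4.
apply: (@recursive_comp k _ _ (nth F1 [:: F1; F2; F3; F4]) rf).
by case=> [|[|[|[|i]]]].
Qed.

Lemma recursive_comp5 k (f : nat -> nat -> nat -> nat -> nat -> nat) F1 F2 F3 F4 F5 :
  recursive 5 (fun v =>
    f (nth 0 v 0) (nth 0 v 1) (nth 0 v 2) (nth 0 v 3) (nth 0 v 4)) ->
  recursive k F1 -> recursive k F2 -> recursive k F3 -> recursive k F4 ->
  recursive k F5 ->
  recursive k (fun v => f (F1 v) (F2 v) (F3 v) (F4 v) (F5 v)).
Proof.
move=> rf r1 r2 r3 r4 r5.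
apply: (@recursive_comp k _ _ (nth F1 [:: F1; F2; F3; F4; F5]) rf).
by case=> [|[|[|[|[|i]]]]].
Qed.

Lemma recursive_const k c : recursive k (fun=> c).
Proof.
elim: c => [|c IH]; first by exists (RecZero k).
by apply: (@recursive_comp1 k succn (fun=> c)) => //; exists RecSucc.
Qed.

Lemma recursive_prim k (g : seq nat -> nat) (h : seq nat -> nat -> nat -> nat) :
  recursive k g ->
  recursive k.+2 (fun w => h (behead (behead w)) (nth 0 w 0) (nth 0 w 1)) ->
  recursive k.+1 (fun v => nat_rect (fun=> nat) (g (behead v)) (h (behead v))
                             (nth 0 v 0)).
Proof.
move=> [rg rgE] [rh rhE]; exists (RecPrim rg rh) => -[|x v] //= [vk].
elim: x => [|i IH] /=; first exact: rgE.
by eexists; [exact: IH | apply: (rhE [:: _, _ & v]) => /=; rewrite vk].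
Qed.

(** [RecMin] looks for a zero, hence the negation; its characteristic function is total and equals
    [0.+1] below the least witness. *)
Lemma recursive_min k (P : seq nat -> nat -> bool) (g : seq nat -> nat) :
  recursive k.+1 (fun w => nat_of_bool (~~ P (behead w) (nth 0 w 0))) ->
  (forall v, P v (g v)) -> (forall v i, P v i -> g v <= i) -> recursive k g.
Proof.
move=> [f fE] Pg gmin; exists (RecMin f) => v vk /=; split.
  by have := fE (g v :: v); rewrite /= Pg vk; apply.
move=> i ilt; exists 0; have := fE (i :: v) => /=; rewrite vk => /(_ erefl).
by case: (boolP (P v i)) => // /gmin; rewrite leqNgt ilt.
Qed.

(** The bounded quantifiers are named to give [rec_step] a head symbol to match. *)
Definition existsb_lt b (P : nat -> bool) := has P (iota 0 b).
Definition forallb_lt b (P : nat -> bool) := all P (iota 0 b).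

Lemma existsb_ltP b (P : nat -> bool) :
  reflect (exists2 i, i < b & P i) (existsb_lt b P).
Proof.
by apply: (iffP hasP) => -[i]; [rewrite mem_iota => ? ?|move=> ib ?];
   exists i => //; rewrite mem_iota.
Qed.

Lemma forallb_ltP b (P : nat -> bool) :
  reflect (forall i, i < b -> P i) (forallb_lt b P).
Proof.
apply: (iffP allP) => H i ib; apply: H; first by rewrite mem_iota.
by move: ib; rewrite mem_iota.
Qed.

(** Each bounded quantifier pushes its variable on the argument list, so that outer variables appear
    under iterated [behead]. *)
Lemma recursive_proj_behead k j i : i + j < k ->
  recursive k (fun v => nth 0 (iter j behead v) i).
Proof.
move=> ik; apply: eq_recursive (recursive_proj ik) => v _.
elim: j i {ik} => [|j IH] i; first by rewrite addn0.
by rewrite addnS -addSn IH iterS nth_behead.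
Qed.

Ltac rec_var :=
  cbv beta;
  first [ apply: (@recursive_proj_behead _ 0) | apply: (@recursive_proj_behead _ 1)
        | apply: (@recursive_proj_behead _ 2) | apply: (@recursive_proj_behead _ 3)
        | apply: (@recursive_proj_behead _ 4) | apply: (@recursive_proj_behead _ 5)
        | apply: (@recursive_proj_behead _ 6) | apply: (@recursive_proj_behead _ 7) ];
  by [].

(** A test is a primitive recursion on 0 or 1 whose step ignores the counter and the previous
    value. *)
Lemma recursive_bif k P F G : recursive k (fun v => nat_of_bool (P v)) ->
  recursive k F -> recursive k G -> recursive k (fun v => if P v then F v else G v).
Proof.
pose h b f g := nat_rect (fun=> nat) g (fun _ _ => f) b.
move=> rP rF rG; have rh : recursive 3 (fun v => h (nth 0 v 0) (nth 0 v 1) (nth 0 v 2)).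
  have := @recursive_prim 2 (fun v => nth 0 v 1) (fun v _ _ => nth 0 v 0).
  move=> /(_ (recursive_proj _)) [] //; first by rec_var.
  by move=> g gE; exists g => v /gE; rewrite !nth_behead.
have := recursive_comp3 rh rP rF rG.
by apply: eq_recursive => v _; case: (P v).
Qed.

Lemma recursive_neg k P : recursive k (fun v => nat_of_bool (P v)) ->
  recursive k (fun v => nat_of_bool (~~ P v)).
Proof.
move=> rP; have := recursive_bif rP (recursive_const k 0) (recursive_const k 1).
apply: eq_recursive.
by move=> v _; case: (P v).
Qed.

Lemma recursive_and k P Q : recursive k (fun v => nat_of_bool (P v)) ->
  recursive k (fun v => nat_of_bool (Q v)) ->
  recursive k (fun v => nat_of_bool (P v && Q v)).
Proof.
move=> rP rQ; apply: eq_recursive (recursive_bif rP rQ (recursive_const k 0)).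
by move=> v _; case: (P v).
Qed.

Lemma recursive_or k P Q : recursive k (fun v => nat_of_bool (P v)) ->
  recursive k (fun v => nat_of_bool (Q v)) ->
  recursive k (fun v => nat_of_bool (P v || Q v)).
Proof.
move=> rP rQ; apply: eq_recursive (recursive_bif rP (recursive_const k 1) rQ).
by move=> v _; case: (P v).
Qed.

Lemma recursive_imply k P Q : recursive k (fun v => nat_of_bool (P v)) ->
  recursive k (fun v => nat_of_bool (Q v)) ->
  recursive k (fun v => nat_of_bool (P v ==> Q v)).
Proof.
move=> rP rQ; apply: eq_recursive (recursive_bif rP rQ (recursive_const k 1)).
by move=> v _; case: (P v).
Qed.

Lemma recursive_eq0 : recursive 1 (fun v => nat_of_bool (nth 0 v 0 == 0)).
Proof.
have := @recursive_prim 0 (fun=> 1) (fun _ _ _ => 0).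
move=> /(_ (recursive_const _ _) (recursive_const _ _)).
by apply: eq_recursive => v _; case: (nth 0 v 0).
Qed.

Lemma recursive_eq1 : recursive 1 (fun v => nat_of_bool (nth 0 v 0 == 1)).
Proof.
have r0 := recursive_comp1 (f := fun i => nat_of_bool (i == 0)) recursive_eq0
  (@recursive_proj 2 0 isT).
have := @recursive_prim 0 (fun=> 0) (fun _ i _ => nat_of_bool (i == 0)).
move=> /(_ (recursive_const _ _) r0).
by apply: eq_recursive => v _; case: (nth 0 v 0).
Qed.

(** Primitive recursion on the bound, with an accumulator that stays at 1 once a witness has been
    met. *)
Lemma recursive_exists k (B : seq nat -> nat) (P : seq nat -> nat -> bool) :
  recursive k B ->
  recursive k.+1 (fun w => nat_of_bool (P (behead w) (nth 0 w 0))) ->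
  recursive k (fun v => nat_of_bool (existsb_lt (B v) (P v))).
Proof.
move=> [b bE] rP; pose h v i z := if z == 1 then 1 else nat_of_bool (P v i).
have [r rE] : recursive k.+1 (fun v =>
    nat_rect (fun=> nat) 0 (h (behead v)) (nth 0 v 0)).
  apply: (@recursive_prim k (fun=> 0) h); first exact: recursive_const.
  apply: recursive_bif; first exact:
    (recursive_comp1 (f := fun i => nat_of_bool (i == 1)) recursive_eq1
       (recursive_proj _)).
    exact: recursive_const.
  (* The step receives the counter, the accumulator and [v], while [P] expects the counter and [v]:
     argument 1 is skipped. *)
  have := @recursive_comp k.+2 _ _
    (fun i w => nth 0 w (if i == 0 then 0 else i.+1)) rP.
  case=> [[|i] ik|q qE]; try exact: recursive_proj.
  exists q => -[|x [|y v]] //= [vk]; have := qE [:: x, y & v]; rewrite /= vk.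
  move/(_ erefl); congr (rec_eval q _ (nat_of_bool (P _ _))).
  apply: (@eq_from_nth _ 0) => [|i]; rewrite size_map size_iota ?vk // => ik.
  by rewrite (nth_map 0) ?size_iota // nth_iota.
have := @recursive_comp k _ _
  (fun i v => if i is j.+1 then nth 0 v j else B v) (ex_intro _ r rE).
case=> [[|i] ik|q qE]; [by exists b | exact: recursive_proj |].
exists q => v vk; have := qE v vk; rewrite /=.
have -> : [seq match i with 0 => B v | j.+1 => nth 0 v j end | i <- iota 1 k] = v.
  apply: (@eq_from_nth _ 0) => [|i]; rewrite size_map size_iota ?vk // => ik.
  by rewrite (nth_map 0) ?size_iota // nth_iota.
congr rec_eval; rewrite /existsb_lt; elim: (B v) => // c IH.
rewrite -[X in iota 0 X]addn1 iotaD has_cat /= IH orbF add0n /h.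
by case: (has _ _).
Qed.

Lemma recursive_forall k (B : seq nat -> nat) (P : seq nat -> nat -> bool) :
  recursive k B ->
  recursive k.+1 (fun w => nat_of_bool (P (behead w) (nth 0 w 0))) ->
  recursive k (fun v => nat_of_bool (forallb_lt (B v) (P v))).
Proof.
move=> rB rP.
have /recursive_neg :=
  recursive_exists (P := fun v i => ~~ P v i) rB (recursive_neg rP).
by apply: eq_recursive => v _; rewrite /existsb_lt has_predC negbK.
Qed.

Lemma recursive_add : recursive 2 (fun v => nth 0 v 0 + nth 0 v 1).
Proof.
have := @recursive_prim 1 (fun v => nth 0 v 0) (fun _ _ z => z.+1).
case=> [||f fE]; [exact: recursive_proj | |].
  by apply: (@recursive_comp1 _ succn); [exists RecSucc | exact: recursive_proj].
exists f => v /fE; congr rec_eval; rewrite nth_behead.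
by elim: (nth 0 v 0) => //= i ->.
Qed.

Lemma recursive_mul : recursive 2 (fun v => nth 0 v 0 * nth 0 v 1).
Proof.
have := @recursive_prim 1 (fun=> 0) (fun v _ z => nth 0 v 0 + z).
case=> [||f fE]; [exact: recursive_const | |].
  by apply: (recursive_comp2 recursive_add); rec_var.
exists f => v /fE; congr rec_eval; rewrite nth_behead.
by elim: (nth 0 v 0) => //= i ->; rewrite mulSn.
Qed.

Lemma recursive_exp : recursive 2 (fun v => nth 0 v 0 ^ nth 0 v 1).
Proof.
have := @recursive_prim 1 (fun=> 1) (fun v _ z => nth 0 v 0 * z).
case=> [||f fE]; [exact: recursive_const | |].
  by apply: (recursive_comp2 recursive_mul); rec_var.
(* The recursion runs on the first argument, so the exponent came first; the arguments are now
   swapped. *)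
have := recursive_comp2 (f := fun n m => nat_rect (fun=> nat) 1 (fun _ z => m * z) n).
move=> /(_ 2 (nth 0 ^~ 1) (nth 0 ^~ 0)) [||| g gE]; try exact: recursive_proj.
  by exists f => v /fE; rewrite nth_behead.
exists g => v /gE; congr rec_eval.
by elim: (nth 0 v 1) => //= i ->; rewrite expnS.
Qed.

Lemma recursive_pred : recursive 1 (fun v => (nth 0 v 0).-1).
Proof.
have := @recursive_prim 0 (fun=> 0) (fun _ i _ => i).
case=> [||f fE]; [exact: recursive_const | exact: recursive_proj |].
by exists f => v /fE; congr rec_eval; case: (nth 0 v 0).
Qed.

Lemma recursive_sub : recursive 2 (fun v => nth 0 v 0 - nth 0 v 1).
Proof.
have := @recursive_prim 1 (fun v => nth 0 v 0) (fun _ _ z => z.-1).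
case=> [||f fE]; [exact: recursive_proj | |].
  by apply: (recursive_comp1 recursive_pred); rec_var.
have := recursive_comp2 (f := fun n m => nat_rect (fun=> nat) m (fun _ z => z.-1) n).
move=> /(_ 2 (nth 0 ^~ 1) (nth 0 ^~ 0)) [||| g gE]; try exact: recursive_proj.
  by exists f => v /fE; rewrite nth_behead.
exists g => v /gE; congr rec_eval.
by elim: (nth 0 v 1) => //= [|i ->]; rewrite ?subn0 ?subnS.
Qed.

Lemma recursive_leq : recursive 2 (fun v => nat_of_bool (nth 0 v 0 <= nth 0 v 1)).
Proof.
exact: (@recursive_comp1 _ (fun x => nat_of_bool (x == 0)) _
          recursive_eq0 recursive_sub).
Qed.

Lemma recursive_eqn : recursive 2 (fun v => nat_of_bool (nth 0 v 0 == nth 0 v 1)).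
Proof.
apply: (@eq_recursive _ (fun v =>
  nat_of_bool ((nth 0 v 0 <= nth 0 v 1) && (nth 0 v 1 <= nth 0 v 0)))).
  by move=> v _; rewrite eqn_leq.
apply: recursive_and; first exact: recursive_leq.
by apply: (@recursive_comp2 _ (fun x y => nat_of_bool (x <= y)) _ _
             recursive_leq); rec_var.
Qed.

(** For a zero divisor the first disjunct holds at once, so that the minimum is 0, in agreement with
    [divn0]. *)
Lemma recursive_divn : recursive 2 (fun v => nth 0 v 0 %/ nth 0 v 1).
Proof.
apply: (@recursive_min _ (fun v q =>
  (nth 0 v 1 == 0) || (nth 0 v 0 < q.+1 * nth 0 v 1))).
- apply: recursive_neg; apply: recursive_or.
    by apply: (@recursive_comp1 _ (fun x => nat_of_bool (x == 0)) _
                 recursive_eq0); rec_var.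
  apply: (@recursive_comp2 _ (fun x y => nat_of_bool (x <= y)) _ _ recursive_leq).
    by apply: (@recursive_comp1 _ succn); [exists RecSucc | rec_var].
  apply: (recursive_comp2 recursive_mul); last by rec_var.
  by apply: (@recursive_comp1 _ succn); [exists RecSucc | rec_var].
- by move=> v; case: posnP => //= d0; apply: ltn_ceil.
- move=> v i; case: posnP => [->|d0] /=; first by rewrite divn0.
  by rewrite -ltn_divLR.
Qed.

Lemma recursive_modn : recursive 2 (fun v => nth 0 v 0 %% nth 0 v 1).
Proof.
apply: (@eq_recursive _ (fun v => nth 0 v 0 - nth 0 v 0 %/ nth 0 v 1 * nth 0 v 1)).
  by move=> v _; rewrite {1}(divn_eq (nth 0 v 0) (nth 0 v 1)) addKn.
apply: (recursive_comp2 recursive_sub); first by rec_var.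
apply: (recursive_comp2 recursive_mul); last by rec_var.
exact: recursive_divn.
Qed.

Lemma recursive_succ : recursive 1 (fun v => (nth 0 v 0).+1).
Proof. by exists RecSucc. Qed.

Create HintDb recdb.
#[local] Hint Resolve recursive_add recursive_mul recursive_exp recursive_pred
  recursive_sub recursive_leq recursive_eqn recursive_divn recursive_modn
  recursive_succ : recdb.

(** Connectives and bounded quantifiers are decomposed by their closure lemmas; other head symbols
    must be registered in [recdb]. *)
Ltac rec_step :=
  lazymatch goal with
  | |- recursive _ (fun v => nth 0 _ ?i) => rec_var
  | |- recursive _ (fun _ => ?c) => refine (recursive_const _ _)
  | |- recursive _ (fun v => nat_of_bool (andb (@?P v) (@?Q v))) =>
      refine (recursive_and (P := P) (Q := Q) _ _)
  | |- recursive _ (fun v => nat_of_bool (orb (@?P v) (@?Q v))) =>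
      refine (recursive_or (P := P) (Q := Q) _ _)
  | |- recursive _ (fun v => nat_of_bool (implb (@?P v) (@?Q v))) =>
      refine (recursive_imply (P := P) (Q := Q) _ _)
  | |- recursive _ (fun v => nat_of_bool (negb (@?P v))) =>
      refine (recursive_neg (P := P) _)
  | |- recursive _ (fun v => nat_of_bool (existsb_lt (@?B v) (@?P v))) =>
      refine (recursive_exists (B := B) (P := P) _ _)
  | |- recursive _ (fun v => nat_of_bool (forallb_lt (@?B v) (@?P v))) =>
      refine (recursive_forall (B := B) (P := P) _ _)
  | |- recursive _ (fun v => nat_of_bool (@eq_op _ (@?A v) (@?B v))) =>
      refine (@recursive_comp2 _ (fun a b => nat_of_bool (a == b)) A B
                recursive_eqn _ _)
  | |- recursive _ (fun v => nat_of_bool (?f (@?A v) (@?B v) (@?C v) (@?D v) (@?E v))) =>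
      refine (@recursive_comp5 _ (fun a b c d e => nat_of_bool (f a b c d e))
                A B C D E _ _ _ _ _ _);
      [solve [auto with recdb nocore] | ..]
  | |- recursive _ (fun v => nat_of_bool (?f (@?A v) (@?B v) (@?C v) (@?D v))) =>
      refine (@recursive_comp4 _ (fun a b c d => nat_of_bool (f a b c d))
                A B C D _ _ _ _ _);
      [solve [auto with recdb nocore] | ..]
  | |- recursive _ (fun v => nat_of_bool (?f (@?A v) (@?B v) (@?C v))) =>
      refine (@recursive_comp3 _ (fun a b c => nat_of_bool (f a b c)) A B C _ _ _ _);
      [solve [auto with recdb nocore] | ..]
  | |- recursive _ (fun v => nat_of_bool (?f (@?A v) (@?B v))) =>
      refine (@recursive_comp2 _ (fun a b => nat_of_bool (f a b)) A B _ _ _);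
      [solve [auto with recdb nocore] | ..]
  | |- recursive _ (fun v => ?f (@?A v) (@?B v) (@?C v) (@?D v) (@?E v)) =>
      refine (@recursive_comp5 _ f A B C D E _ _ _ _ _ _);
      [solve [auto with recdb nocore] | ..]
  | |- recursive _ (fun v => ?f (@?A v) (@?B v) (@?C v)) =>
      refine (@recursive_comp3 _ f A B C _ _ _ _);
      [solve [auto with recdb nocore] | ..]
  | |- recursive _ (fun v => ?f (@?A v) (@?B v)) =>
      refine (@recursive_comp2 _ f A B _ _ _);
      [solve [auto with recdb nocore] | ..]
  | |- recursive _ (fun v => ?f (@?A v)) =>
      refine (@recursive_comp1 _ f A _ _);
      [solve [auto with recdb nocore] | ..]
  end; cbv beta.

Ltac rec_tac := cbv beta; repeat rec_step.

(** * The search formula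

    A matrix modulo [L] is coded by the number [x < L ^ 4] whose base-[L] digits
    are its entries, and a set of such matrices by the binary digits of a number
    [s < 2 ^ (L ^ 4)].  A list of numbers has the code [CodeSeq.code] used by
    [pickle].  A suffix [c] marks the counterpart of a notion on these codes; the
    pair [n], [l] stands for a presentation. *)

Definition bit s x := (s %/ 2 ^ x) %% 2 == 1.

(* In [CodeSeq.code [:: n1; n2; ...]], each [ni] is written in binary as a 1
   followed on its right by [ni] zeros; an item thus starts at position 0 or just
   above a digit 1. *)
Definition code_mem z c := existsb_lt c.+1 (fun k =>
  ((k == 0) || bit c k.-1) && ((c %/ 2 ^ k) %% 2 ^ z.+1 == 2 ^ z)).

(** The closed form of [CodeSeq.code [:: a; b]], which is how a pair is pickled. *)
Definition code_pair a b := 2 ^ a * (2 ^ b.+1).+1.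

Definition ent L k x := (x %/ L ^ k) %% L.

Definition enc L a b c d :=
  a %% L + b %% L * L + c %% L * L ^ 2 + d %% L * L ^ 3.

Definition code_quad a b c d := code_pair (code_pair (code_pair a b) c) d.

Definition code_ent L x :=
  code_quad (ent L 0 x) (ent L 1 x) (ent L 2 x) (ent L 3 x).

Definition mulc L x y :=
  enc L (ent L 0 x * ent L 0 y + ent L 1 x * ent L 2 y)
        (ent L 0 x * ent L 1 y + ent L 1 x * ent L 3 y)
        (ent L 2 x * ent L 0 y + ent L 3 x * ent L 2 y)
        (ent L 2 x * ent L 1 y + ent L 3 x * ent L 3 y).

Definition onec L := enc L 1 0 0 1.

Definition eqc m L c x y :=
  [&& ent L 0 x == c * ent L 0 y %[mod m], ent L 1 x == c * ent L 1 y %[mod m],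
      ent L 2 x == c * ent L 2 y %[mod m] & ent L 3 x == c * ent L 3 y %[mod m]].

(** Subtraction is truncated on natural numbers, so the antidiagonal product of the determinant is
    moved to the right-hand side, here and in [slc]. *)
Definition unitc L x := existsb_lt L (fun u =>
  ent L 0 x * ent L 3 x * u == ent L 1 x * ent L 2 x * u + 1 %[mod L]).

Definition slc L x :=
  ent L 0 x * ent L 3 x == ent L 1 x * ent L 2 x + 1 %[mod L].

(** The bound [l] is large enough: a list code exceeds its items, and a pair code exceeds its
    components. *)
Definition matchc n l L x :=
  existsb_lt l (fun a => existsb_lt l (fun b =>
  existsb_lt l (fun c => existsb_lt l (fun d =>
    [&& code_mem (code_quad a b c d) l,
        ent L 0 x == a %[mod n], ent L 1 x == b %[mod n],
        ent L 2 x == c %[mod n] & ent L 3 x == d %[mod n]])))).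

Definition inc n l L x := unitc L x && matchc n l L x.

Definition subgroupc L s :=
  [&& bit s (onec L),
      forallb_lt (L ^ 4) (fun x => forallb_lt (L ^ 4) (fun y =>
        bit s x ==> bit s y ==> bit s (mulc L x y))) &
      forallb_lt (L ^ 4) (fun x => forallb_lt (L ^ 4) (fun y =>
        bit s x ==> (mulc L x y == onec L) ==> bit s y))].

(** For invertible [x] and [y], the equation [y x z = x y] singles out the commutator [z] without
    computing an inverse. *)
Definition commc n l L s :=
  forallb_lt (L ^ 4) (fun x => forallb_lt (L ^ 4) (fun y => forallb_lt (L ^ 4) (fun z =>
    inc n l L x ==> inc n l L y ==>
    (mulc L (mulc L y x) z == mulc L x y) ==> bit s z))).

Definition ker_subc n l L m :=
  [&& 0 < m, L %% m == 0 &
      forallb_lt (L ^ 4) (fun x =>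
        unitc L x ==> eqc m L 1 x (onec L) ==> inc n l L x)].

(** Membership in the closed commutator subgroup is expressed as membership in every subgroup modulo
    [L] that contains the commutators. *)
Definition sker_subc n l L m :=
  [&& 0 < m, L %% m == 0 &
      forallb_lt (2 ^ (L ^ 4)) (fun s => subgroupc L s ==> commc n l L s ==>
        forallb_lt (L ^ 4) (fun x =>
          slc L x ==> eqc m L 1 x (onec L) ==> bit s x))].

(** The least common multiple of the two levels is the least modulus whose kernels lie in both
    groups at once, so the levels need not be found separately. *)
Definition levelc n l L N :=
  [&& ker_subc n l L N, sker_subc n l L N &
      forallb_lt N (fun m => ~~ (ker_subc n l L m && sker_subc n l L m))].

Definition interc n l L s :=
  [&& subgroupc L s, commc n l L s &
      forallb_lt (L ^ 4) (fun x => bit s x ==> inc n l L x && slc L x)].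

Definition liftc L N s x :=
  unitc L x && existsb_lt (L ^ 4) (fun y => bit s y &&
    existsb_lt L (fun v => existsb_lt L (fun u => v * u == 1 %[mod L]) &&
                    eqc N L (v ^ (2 ^ N)) x y)).

(** The list in [q] is prescribed only as a set, with order and repetitions left free; [outc] treats
    the output in the same way. *)
Definition presc L N q s :=
  existsb_lt q (fun g => [&& q == code_pair L g,
    forallb_lt g (fun z => code_mem z g ==>
      existsb_lt (L ^ 4) (fun x => (z == code_ent L x) && liftc L N s x)) &
    forallb_lt (L ^ 4) (fun x => liftc L N s x ==> code_mem (code_ent L x) g)]).

Definition outc n l L N y :=
  forallb_lt y (fun q => code_mem q y ==>
    existsb_lt (2 ^ (L ^ 4)) (fun s => interc n l L s && presc L N q s)) &&
  forallb_lt (2 ^ (L ^ 4)) (fun s => interc n l L s ==>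
    existsb_lt y (fun q => code_mem q y && presc L N q s)).

(** The bound on [N] suffices because [N] divides [4 * n ^ 4]. *)
Definition solc p y :=
  existsb_lt p (fun n => existsb_lt p (fun l => (p == code_pair n l) &&
    existsb_lt (4 * n ^ 4).+1 (fun N =>
      levelc n l (4 * n ^ 4) N && outc n l (4 * n ^ 4) N y))).

(** * Recursiveness of the formula *)

Local Notation rec1 f := (recursive 1 (fun v => f (nth 0 v 0))).
Local Notation rec2 f := (recursive 2 (fun v => f (nth 0 v 0) (nth 0 v 1))).
Local Notation rec3 f := (recursive 3 (fun v => f (nth 0 v 0) (nth 0 v 1) (nth 0 v 2))).
Local Notation rec4 f := (recursive 4 (fun v =>
  f (nth 0 v 0) (nth 0 v 1) (nth 0 v 2) (nth 0 v 3))).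
Local Notation rec5 f := (recursive 5 (fun v =>
  f (nth 0 v 0) (nth 0 v 1) (nth 0 v 2) (nth 0 v 3) (nth 0 v 4))).

Lemma recursive_bit : rec2 bit. Proof. rewrite /bit; rec_tac. Qed.
#[local] Hint Resolve recursive_bit : recdb.
Lemma recursive_code_mem : rec2 code_mem.
Proof. rewrite /code_mem; rec_tac. Qed.
#[local] Hint Resolve recursive_code_mem : recdb.
Lemma recursive_code_pair : rec2 code_pair. Proof. rewrite /code_pair; rec_tac. Qed.
#[local] Hint Resolve recursive_code_pair : recdb.
Lemma recursive_ent : rec3 ent. Proof. rewrite /ent; rec_tac. Qed.
#[local] Hint Resolve recursive_ent : recdb.
Lemma recursive_enc : rec5 enc. Proof. rewrite /enc; rec_tac. Qed.
#[local] Hint Resolve recursive_enc : recdb.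
Lemma recursive_code_ent : rec2 code_ent.
Proof. rewrite /code_ent /code_quad; rec_tac. Qed.
#[local] Hint Resolve recursive_code_ent : recdb.
Lemma recursive_mulc : rec3 mulc. Proof. rewrite /mulc; rec_tac. Qed.
#[local] Hint Resolve recursive_mulc : recdb.
Lemma recursive_onec : rec1 onec. Proof. rewrite /onec; rec_tac. Qed.
#[local] Hint Resolve recursive_onec : recdb.
Lemma recursive_eqc : rec5 eqc. Proof. rewrite /eqc; rec_tac. Qed.
#[local] Hint Resolve recursive_eqc : recdb.
Lemma recursive_unitc : rec2 unitc. Proof. rewrite /unitc; rec_tac. Qed.
#[local] Hint Resolve recursive_unitc : recdb.
Lemma recursive_slc : rec2 slc. Proof. rewrite /slc; rec_tac. Qed.
#[local] Hint Resolve recursive_slc : recdb.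
Lemma recursive_inc : rec4 inc. Proof. rewrite /inc /matchc /code_quad; rec_tac. Qed.
#[local] Hint Resolve recursive_inc : recdb.
Lemma recursive_subgroupc : rec2 subgroupc. Proof. rewrite /subgroupc; rec_tac. Qed.
#[local] Hint Resolve recursive_subgroupc : recdb.
Lemma recursive_commc : rec4 commc. Proof. rewrite /commc; rec_tac. Qed.
#[local] Hint Resolve recursive_commc : recdb.
Lemma recursive_ker_subc : rec4 ker_subc. Proof. rewrite /ker_subc; rec_tac. Qed.
#[local] Hint Resolve recursive_ker_subc : recdb.
Lemma recursive_sker_subc : rec4 sker_subc. Proof. rewrite /sker_subc; rec_tac. Qed.
#[local] Hint Resolve recursive_sker_subc : recdb.
Lemma recursive_levelc : rec4 levelc. Proof. rewrite /levelc; rec_tac. Qed.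
#[local] Hint Resolve recursive_levelc : recdb.
Lemma recursive_interc : rec4 interc. Proof. rewrite /interc; rec_tac. Qed.
#[local] Hint Resolve recursive_interc : recdb.
Lemma recursive_liftc : rec4 liftc. Proof. rewrite /liftc; rec_tac. Qed.
#[local] Hint Resolve recursive_liftc : recdb.
Lemma recursive_presc : rec4 presc. Proof. rewrite /presc; rec_tac. Qed.
#[local] Hint Resolve recursive_presc : recdb.
Lemma recursive_outc : rec5 outc. Proof. rewrite /outc; rec_tac. Qed.
#[local] Hint Resolve recursive_outc : recdb.
Lemma recursive_solc : rec2 solc. Proof. rewrite /solc; rec_tac. Qed.

(** * Binary digits, codes of lists and of pairs, base-[L] digits *)

Lemma bitE s x : bit s x = odd (s %/ 2 ^ x).
Proof. by rewrite /bit modn2; case: (odd _). Qed.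

Lemma exists_bits K (P : pred nat) :
  exists2 s, s < 2 ^ K & forall x, x < K -> bit s x = P x.
Proof.
elim: K => [|K [s sK sP]]; first by exists 0.
exists (P K * 2 ^ K + s) => [|x].
  rewrite expnS; case: (P K); lia.
rewrite ltnS leq_eqVlt bitE => /predU1P[->|xK].
  by rewrite divnMDl ?expn_gt0 // divn_small // addn0; case: (P K).
rewrite -(sP x) // bitE -[X in _ * 2 ^ X](subnK (ltnW xK)) expnD mulnA.
rewrite divnMDl ?expn_gt0 //.
rewrite oddD oddM oddX.
have -> : (K - x == 0) = false by lia.
by rewrite andbF.
Qed.

(** The factor [c.*2.+1] is odd, so [n] is the number of trailing binary zeros. *)
Lemma mod_code_head n c z :
  (2 ^ n * c.*2.+1 %% 2 ^ z.+1 == 2 ^ z) = (z == n).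
Proof.
case: (ltngtP z n) => [zn|nz|->].
- rewrite -(subnKC zn) expnD -mulnA mulnC modnMl.
  by apply/negbTE; rewrite eq_sym -lt0n expn_gt0.
- apply/negbTE/eqP => E.
  have : 2 ^ n.+1 %| 2 ^ n * c.*2.+1.
    rewrite (divn_eq (2 ^ n * c.*2.+1) (2 ^ z.+1)) E.
    by apply: dvdn_add; [apply: dvdn_mull|]; apply: dvdn_exp2l => //; apply: leqW.
  by rewrite expnSr dvdn_pmul2l ?expn_gt0 // dvdn2 /= odd_double.
- have -> : 2 ^ n * c.*2.+1 = c * 2 ^ n.+1 + 2 ^ n by rewrite expnS; nia.
  by rewrite modnMDl modn_small ?eqxx // ltn_exp2l.
Qed.

Lemma divn_code n c k : 2 ^ n * c.*2.+1 %/ 2 ^ (n.+1 + k) = c %/ 2 ^ k.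
Proof.
have -> : 2 ^ n * c.*2.+1 = c * 2 ^ n.+1 + 2 ^ n by rewrite expnS; nia.
rewrite expnD divnMA divnMDl ?expn_gt0 // (divn_small (d := 2 ^ n.+1)) ?addn0 //.
by rewrite ltn_exp2l.
Qed.

Lemma code_memP z s : code_mem z (CodeSeq.code s) = (z \in s).
Proof.
elim: s => [|n s IH] /=.
  by apply/existsb_ltP => -[[|k]] //=; rewrite div0n mod0n eq_sym expn_eq0.
set c := CodeSeq.code s in IH *; rewrite in_cons -IH.
apply/existsb_ltP/orP => [[[|k] kb]|].
- by rewrite expn0 divn1 mod_code_head => zn; left.
(* The digit at position [k] must be 1. Below [n] the head item has only zeros; position [n] carries
   its 1, just below the tail; larger positions lie inside the tail. *)
- rewrite /= bitE => /andP[kbit]; case: (ltngtP k n) => [kn|nk|kn].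
  + move: kbit; rewrite -(subnKC (ltnW kn)) expnD -mulnA mulKn ?expn_gt0 //.
    by rewrite oddM oddX; have -> : (n - k == 0) = false by lia.
  + have [i ki] : exists i, k = n.+1 + i by exists (k - n.+1); lia.
    rewrite ki divn_code in kbit *; rewrite -addnS divn_code => zc; right.
    apply/existsb_ltP; exists i.+1; rewrite /= ?bitE ?zc ?andbT.
      (* A digit 1 at position [i] gives [2 ^ i <= c], hence [i < c], as the bound of the quantifier
         requires. *)
      rewrite ltnS; case: (posnP c) kbit => [->|c0]; first by rewrite div0n.
      move=> /odd_gt0; rewrite divn_gt0 ?expn_gt0 //.
      by move=> /(leq_trans (ltn_expl i (ltnSn 1))).
    by [].
  + rewrite kn -[n.+1]addn0 divn_code => zc; right.
    by apply/existsb_ltP; exists 0; rewrite //= zc.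
- case=> [/eqP->|/existsb_ltP[k kc /andP[kbit zc]]].
    by exists 0; rewrite //= expn0 divn1 mod_code_head.
  exists (n.+1 + k); last first.
    rewrite divn_code zc andbT addSn /=; case: k kbit {kc zc} => [|k] /=.
      by move=> _; rewrite addn0 bitE mulKn ?expn_gt0 //= odd_double.
    by rewrite bitE addnS -addSn bitE divn_code.
  have : n < 2 ^ n by apply: ltn_expl.
  by rewrite ltnS in kc *; rewrite mulnS; nia.
Qed.

Lemma code_mem_lt z c : code_mem z c -> z < c.
Proof.
rewrite -[c]CodeSeq.decodeK code_memP => zc.
exact: (allP (CodeSeq.ltn_code _)).
Qed.

Lemma code_pairE a b : code_pair a b = CodeSeq.code [:: a; b].
Proof. by rewrite /code_pair /= expnS -muln2; congr (_ * _.+1); lia. Qed.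

Lemma pickle_pairE (T U : countType) (x : T) (y : U) :
  pickle (x, y) = code_pair (pickle x) (pickle y).
Proof. by rewrite code_pairE. Qed.

Lemma pickle_seqE (T : countType) (s : seq T) :
  pickle s = CodeSeq.code (map pickle s).
Proof. by []. Qed.

Lemma code_pair_inj a b c d : code_pair a b = code_pair c d -> a = c /\ b = d.
Proof. by rewrite !code_pairE => /(can_inj CodeSeq.codeK)[]. Qed.

Lemma code_pair_gt a b : a < code_pair a b /\ b < code_pair a b.
Proof.
by rewrite code_pairE; have /= /and3P[-> ->] := CodeSeq.ltn_code [:: a; b].
Qed.

Lemma enc_lt L a b c d : 0 < L -> enc L a b c d < L ^ 4.
Proof.
move=> L0.
have H x y K : y < K -> x %% L + y * L < K * L.
  move=> yK; apply: (@leq_trans (y.+1 * L)); last by rewrite leq_mul2r yK orbT.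
  by rewrite mulSn ltn_add2r ltn_pmod.
have -> : enc L a b c d = a %% L + (b %% L + (c %% L + d %% L * L) * L) * L.
  by rewrite /enc !expnS expn0 muln1 !mulnDl !addnA !mulnA.
by rewrite !expnSr expn0 mul1n !H ?ltn_pmod.
Qed.

Lemma ent_enc L a b c d : 0 < L ->
  [/\ ent L 0 (enc L a b c d) = a %% L, ent L 1 (enc L a b c d) = b %% L,
      ent L 2 (enc L a b c d) = c %% L & ent L 3 (enc L a b c d) = d %% L].
Proof.
move=> L0.
have E : enc L a b c d = a %% L + (b %% L + (c %% L + (d %% L + 0 * L) * L) * L) * L.
  by rewrite /enc !expnS expn0 muln1 mul0n addn0 !mulnDl !addnA !mulnA.
have H x y : (x %% L + y * L) %% L = x %% L by rewrite addnC modnMDl modn_mod.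
have D x y : (x %% L + y * L) %/ L = y.
  by rewrite addnC divnMDl // (divn_small (ltn_pmod x L0)) addn0.
by rewrite /ent !expnS expn0 muln1 divn1 !divnMA E !D !H.
Qed.

Lemma enc_ent L x : 0 < L -> x < L ^ 4 ->
  enc L (ent L 0 x) (ent L 1 x) (ent L 2 x) (ent L 3 x) = x.
Proof.
move=> L0 xL; rewrite /enc /ent !modn_mod !expnS !expn0 muln1 !divnMA divn1.
have H y y1 y2 y3 a b c : y = y1 * L + a -> y1 = y2 * L + b ->
    y2 = y3 * L + c -> a + b * L + c * (L * L) + y3 * (L * (L * L)) = y.
  by move=> -> -> ->; rewrite !mulnDl !mulnA; lia.
rewrite (modn_small (m := x %/ L %/ L %/ L)); first by apply: H; apply: divn_eq.
by rewrite -!divnMA ltn_divLR ?muln_gt0 ?L0 // (leq_trans xL) // !expnS muln1 !mulnA.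
Qed.

Import GRing.Theory.
Local Open Scope ring_scope.

(** * Arithmetic of the profinite integers *)

(** As natural numbers, residues for different moduli have the same type and can be compared. *)
Definition zres (x : Zhat) n : nat := zcomp x n.

Definition zeq n (x y : Zhat) : Prop := zcomp x n = zcomp y n.

Section Residues.
Local Open Scope nat_scope.

Lemma zeqE n x y : zeq n x y <-> zres x n = zres y n.
Proof. by split=> [|/val_inj//]; rewrite /zeq /zres => ->. Qed.

Lemma zres_lt n x : 0 < n -> zres x n < n.
Proof. by case: n => // n _; exact: ltn_ord. Qed.

Lemma zresD n x y : 0 < n -> zres (x + y)%R n = (zres x n + zres y n) %% n.
Proof. by case: n. Qed.

Lemma zresM n x y : 0 < n -> zres (x * y)%R n = (zres x n * zres y n) %% n.
Proof. by case: n. Qed.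

Lemma zres0 n : zres 0%R n = 0.
Proof. by rewrite /zres /= mod0n. Qed.

Lemma zres1 n : 0 < n -> zres 1%R n = 1 %% n.
Proof. by case: n. Qed.

Lemma zres_nat n k : 0 < n -> zres k%:R%R n = k %% n.
Proof.
move=> n0; elim: k => [|k IH]; first by rewrite zres0 mod0n.
by rewrite -addn1 natrD zresD // IH zres1 // modnDm.
Qed.

Lemma zresX n x k : 0 < n -> zres (x ^+ k)%R n = zres x n ^ k %% n.
Proof.
move=> n0; elim: k => [|k IH]; first by rewrite expr0 zres1 // expn0.
by rewrite exprS zresM // IH modnMmr expnS.
Qed.

Lemma zres_dvd m n x : 0 < n -> m %| n -> zres x m = zres x n %% m.
Proof.
move=> n0 mn; have m0 := dvdn_gt0 n0 mn.
by rewrite /zres -(zcomp_compat x n0 mn) /=; case: m m0 {mn}.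
Qed.

Lemma zeq_dvd m n x y : 0 < n -> m %| n -> zeq n x y -> zeq m x y.
Proof. by move=> n0 mn /zeqE xy; apply/zeqE; rewrite !(zres_dvd _ n0 mn) xy. Qed.

Lemma zhat_eqP (x y : Zhat) : (forall n, 0 < n -> zeq n x y) -> x = y.
Proof.
by move=> xy; apply: zhatP => -[|n]; [apply: val_inj; rewrite !ord1 | apply: xy].
Qed.

Lemma zhat_build (f : nat -> nat) :
  (forall m n, 0 < n -> m %| n -> f n = f m %[mod m]) ->
  exists x : Zhat, forall n, 0 < n -> zres x n = f n %% n.
Proof.
move=> Hf; pose c n : 'I_(n.-1.+1) := inZp (f n).
have cP m n : 0 < n -> m %| n -> inZp (c n) = c m.
  move=> n0 mn; have m0 := dvdn_gt0 n0 mn; apply: val_inj => /=.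
  by rewrite !prednK // modn_dvdm // Hf.
by exists (MkZhat cP) => n n0; rewrite /zres /= prednK.
Qed.

End Residues.

Lemma zeq_refl n x : zeq n x x. Proof. by []. Qed.
Lemma zeq_sym n x y : zeq n x y -> zeq n y x. Proof. by rewrite /zeq => ->. Qed.
Lemma zeq_trans n x y z : zeq n x y -> zeq n y z -> zeq n x z.
Proof. by rewrite /zeq => ->. Qed.
Lemma zeqD n x y z t : zeq n x y -> zeq n z t -> zeq n (x + z) (y + t).
Proof. exact: (congr2 (@Zp_add _)). Qed.
Lemma zeqM n x y z t : zeq n x y -> zeq n z t -> zeq n (x * z) (y * t).
Proof. exact: (congr2 (@Zp_mul _)). Qed.
Lemma zeqN n x y : zeq n x y -> zeq n (- x) (- y).
Proof. exact: (congr1 (@Zp_opp _)). Qed.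
Lemma zeqB n x y z t : zeq n x y -> zeq n z t -> zeq n (x - z) (y - t).
Proof. by move=> xy zt; apply: zeqD => //; apply: zeqN. Qed.
Lemma zeqX n x y k : zeq n x y -> zeq n (x ^+ k) (y ^+ k).
Proof. by move=> xy; elim: k => [|k IH] //; rewrite !exprS; apply: zeqM. Qed.

Lemma zeq_sub0 n x y : zeq n (x - y) 0 <-> zeq n x y.
Proof.
split=> [xy|xy]; last by rewrite -(subrr y); apply: zeqB.
by rewrite -[x](subrK y) -[y in zeq n _ y]add0r; apply: zeqD.
Qed.

Lemma zeq_natr n k : (0 < n)%N -> (n %| k)%N -> zeq n k%:R 0.
Proof. by move=> n0 /eqP nk; apply/zeqE; rewrite zres_nat // zres0. Qed.

Lemma zeq_multiple n x : (0 < n)%N -> zeq n x 0 -> exists y, x = n%:R * y.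
Proof.
move=> n0 /zeqE; rewrite zres0 => xn.
(* The quotient modulo [k] is read off [x] modulo [n * k]. *)
have [|y yE] := @zhat_build (fun k => zres x (n * k) %/ n)%N.
  move=> m k k0 mk; have m0 := dvdn_gt0 k0 mk.
  have nk0 : (0 < n * k)%N by rewrite muln_gt0 n0.
  have nmk : (n * m %| n * k)%N by rewrite dvdn_pmul2l.
  rewrite (zres_dvd _ nk0 nmk).
  rewrite {1}(divn_eq (zres x (n * k)) (n * m)) (mulnC n m) mulnA divnMDl //.
  by rewrite modnMDl.
exists y; apply: zhat_eqP => k k0; apply/zeqE.
have nk0 : (0 < n * k)%N by rewrite muln_gt0 n0.
rewrite zresM // zres_nat // yE // modnMm mulnC divnK.
  by rewrite (zres_dvd x nk0 (dvdn_mull n (dvdnn k))).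
by rewrite /dvdn -(zres_dvd x nk0 (dvdn_mulr k (dvdnn n))) xn.
Qed.

(** Non-vanishing at all primes makes each residue coprime to its modulus; the inverses form a
    compatible family because an inverse modulo [m] is unique. *)
Lemma zunitP x : x \is a GRing.unit <-> (forall p, prime p -> ~ zeq p x 0).
Proof.
split=> [ux p pp x0|xp].
  have : zeq p (x * x^-1) (0 * x^-1) by apply: zeqM.
  rewrite mulrV // mul0r => /zeqE; rewrite zres0 zres1 ?prime_gt0 //.
  by rewrite modn_small // prime_gt1.
have inv n : exists u, (0 < n)%N -> (zres x n * u = 1 %[mod n])%N.
  case: (posnP n) => [->|n0]; first by exists 0%N.
  have co : coprime n (zres x n).
    apply: contraT => g1; have {}g1 : (1 < gcdn n (zres x n))%N.
      by rewrite ltn_neqAle eq_sym g1 gcdn_gt0 n0.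
    have [pn px] : (pdiv (gcdn n (zres x n)) %| n)%N /\
                   (pdiv (gcdn n (zres x n)) %| zres x n)%N.
      by split; apply: dvdn_trans (pdiv_dvd _) _; rewrite ?dvdn_gcdl ?dvdn_gcdr.
    case: (xp _ (pdiv_prime g1)); apply/zeqE.
    by rewrite zres0 (zres_dvd _ n0 pn); apply/eqP.
  (* A number that is 1 modulo [n] and a multiple of the residue yields the inverse as cofactor. *)
  have : (zres x n %| chinese n (zres x n) 1 0)%N.
    by rewrite /dvdn chinese_modr // mod0n.
  case/dvdnP=> u uE; exists u => _.
  by rewrite mulnC -uE chinese_modl.
have [u uE] := choice inv.
have [|y yE] := @zhat_build u.
  move=> m n n0 mn; have m0 := dvdn_gt0 n0 mn.
  have E1 : (zres x m * u n = 1 %[mod m])%N.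
    rewrite (zres_dvd _ n0 mn) modnMml.
    by have /(congr1 (modn^~ m)) := uE n n0; rewrite !modn_dvdm.
  transitivity ((zres x m * u n * u m) %% m)%N.
    by rewrite mulnAC -modnMml uE // modnMml mul1n.
  by rewrite -modnMml E1 modnMml mul1n.
apply/unitrP; exists y; suff xy : x * y = 1 by rewrite [y * x]mulrC.
apply: zhat_eqP => n n0; apply/zeqE.
by rewrite zresM // zres1 // yE // modnMmr uE.
Qed.

Lemma zunit_coprime n x : (0 < n)%N -> x \is a GRing.unit -> coprime (zres x n) n.
Proof.
move=> n0 ux; have : zeq n (x * x^-1) 1 by rewrite mulrV.
move=> /zeqE; rewrite zresM // zres1 // => vV.
have := coprime1n n; rewrite -coprime_modl -vV coprime_modl coprimeMl.
by case/andP.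
Qed.

(** In the product of the rings of [p]-adic integers, [e] is the projector on the factors with [p]
    in [pi]. It is the tool for prescribing numbers and matrices prime by prime. *)
Lemma exists_idempotent (pi : pred nat) : exists e : Zhat,
  [/\ e * e = e,
      forall n, (0 < n)%N -> (forall p, prime p -> (p %| n)%N -> pi p) ->
        zeq n e 1 &
      forall n, (0 < n)%N -> (forall p, prime p -> (p %| n)%N -> ~~ pi p) ->
        zeq n e 0].
Proof.
pose P : nat_pred := [pred p | pi p].
pose f n := chinese n`_P n`_P^' 1 0.
have f1 n m : (0 < n)%N -> (m %| n`_P)%N -> (f n = 1 %[mod m])%N.
  move=> n0 mn; have := chinese_modl (coprime_partC P n n) 1 0.
  by move=> /(congr1 (modn^~ m)); rewrite !modn_dvdm.
have f0 n m : (0 < n)%N -> (m %| n`_P^')%N -> (f n = 0 %[mod m])%N.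
  move=> n0 mn; have := chinese_modr (coprime_partC P n n) 1 0.
  by move=> /(congr1 (modn^~ m)); rewrite !modn_dvdm.
have fP n a b : (0 < n)%N -> (a = b %[mod n`_P])%N -> (a = b %[mod n`_P^'])%N ->
    (a = b %[mod n])%N.
  move=> n0 ab ab'; apply/eqP; rewrite -(partnC P n0).
  by rewrite chinese_remainder ?coprime_partC // ab ab' !eqxx.
have [|e eE] := @zhat_build f.
  move=> m n n0 mn; have m0 := dvdn_gt0 n0 mn.
  apply: fP => //; first by rewrite (f1 n) ?partn_dvd // (f1 m).
  by rewrite (f0 n) ?partn_dvd // (f0 m).
exists e; split.
- apply: zhat_eqP => n n0; apply/zeqE; rewrite zresM // !eE // modnMm.
  apply: fP => //; first by rewrite -modnMm (f1 n) // modnMm.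
  by rewrite -modnMm (f0 n) // modnMm.
- move=> n n0 np; apply/zeqE; rewrite eE // zres1 // f1 // part_pnat_id //.
  exact/pnatP.
- move=> n n0 np; apply/zeqE; rewrite eE // zres0 f0 ?mod0n // part_pnat_id //.
  exact/pnatP.
Qed.

Local Open Scope classical_set_scope.

(** * Matrices, levels and commutators *)

Lemma ord2P (P : 'I_2 -> Prop) : P 0 -> P 1 -> forall i, P i.
Proof.
move=> P0 P1 [[|[|i]] // Hi].
  by have -> : Ordinal Hi = 0 by apply: val_inj.
by have -> : Ordinal Hi = 1 by apply: val_inj.
Qed.

Definition mx2 (R : Type) (a b c d : R) : 'M[R]_2 :=
  \matrix_(i, j) (if i == 0 then if j == 0 then a else b
                  else if j == 0 then c else d).

Lemma mx2E (R : Type) (a b c d : R) :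
  ((mx2 a b c d 0 0 = a) * (mx2 a b c d 0 1 = b)
   * (mx2 a b c d 1 0 = c) * (mx2 a b c d 1 1 = d))%type.
Proof. by rewrite !mxE. Qed.

Lemma mx2_eta (R : Type) (A : 'M[R]_2) : A = mx2 (A 0 0) (A 0 1) (A 1 0) (A 1 1).
Proof. by apply/matrixP; apply: ord2P; apply: ord2P; rewrite mx2E. Qed.

Lemma mulmx2 (R : pzRingType) (a b c d a' b' c' d' : R) :
  mx2 a b c d *m mx2 a' b' c' d' =
  mx2 (a * a' + b * c') (a * b' + b * d') (c * a' + d * c') (c * b' + d * d').
Proof.
apply/matrixP; apply: ord2P; apply: ord2P; rewrite mx2E mxE;
  by rewrite big_ord_recl big_ord_recl big_ord0 addr0 !mxE.
Qed.

Lemma mx2_1 (R : pzRingType) : 1%:M = mx2 1 0 0 1 :> 'M[R]_2.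
Proof. by apply/matrixP; apply: ord2P; apply: ord2P; rewrite !mxE. Qed.

Lemma det_mx2 (R : comPzRingType) (A : 'M[R]_2) :
  \det A = A 0 0 * A 1 1 - A 0 1 * A 1 0.
Proof.
rewrite (expand_det_row _ 0) big_ord_recl big_ord_recl big_ord0 addr0.
rewrite /cofactor !det_mx11 !mxE /= expr0 expr1 mul1r mulN1r mulrN.
by congr (_ * A _ _ - A _ _ * A _ _); apply: val_inj.
Qed.

Lemma mx_eqmodP n (A B : 'M[Zhat]_2) : mx_eqmod n A B <->
  [/\ zeq n (A 0 0) (B 0 0), zeq n (A 0 1) (B 0 1),
      zeq n (A 1 0) (B 1 0) & zeq n (A 1 1) (B 1 1)].
Proof.
split=> [AB|[? ? ? ?]]; first by split; apply: AB.
by apply: ord2P; apply: ord2P.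
Qed.

Lemma mx_eqmod_sym n A B : mx_eqmod n A B -> mx_eqmod n B A.
Proof. by move=> AB i j; rewrite AB. Qed.

Lemma mx_eqmod_trans n B A C :
  mx_eqmod n A B -> mx_eqmod n B C -> mx_eqmod n A C.
Proof. by move=> AB BC i j; rewrite AB. Qed.

Lemma mx_eqmodM n A A' B B' : mx_eqmod n A A' -> mx_eqmod n B B' ->
  mx_eqmod n (A *m B) (A' *m B').
Proof.
move=> AA BB i j; rewrite !mxE.
apply: (big_ind2 (fun x y => zeq n x y)) => [//|? ? ? ?|k _]; first exact: zeqD.
by apply: zeqM; [apply: AA | apply: BB].
Qed.

Lemma mx_eqmod_det n A B : mx_eqmod n A B -> zeq n (\det A) (\det B).
Proof.
by case/mx_eqmodP=> ? ? ? ?; rewrite !det_mx2; apply: zeqB; apply: zeqM.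
Qed.

Lemma mx_eqmod_dvd m n A B : (0 < n)%N -> (m %| n)%N ->
  mx_eqmod n A B -> mx_eqmod m A B.
Proof. by move=> n0 mn AB i j; apply: (zeq_dvd n0 mn); apply: AB. Qed.

Lemma mx_of_mul (A B : GL2Zhat) : mx_of (A * B)%g = A *m B. Proof. by []. Qed.
Lemma mx_of_1 : mx_of 1%g = 1%:M. Proof. by []. Qed.

Lemma det_gl2_unit (A : GL2Zhat) : \det A \is a GRing.unit.
Proof. by rewrite -unitmxE mx_unit. Qed.

Lemma exists_gl2 (A : 'M[Zhat]_2) :
  \det A \is a GRing.unit -> exists B : GL2Zhat, mx_of B = A.
Proof. by rewrite -unitmxE => uA; exists (MkGL2 uA). Qed.

Lemma ker_modE n (A B : GL2Zhat) : mx_eqmod n A B <-> ker_mod n (A * B^-1)%g.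
Proof.
rewrite /ker_mod /=; split=> H.
  by rewrite -mx_of_1 -(mulgV B) !mx_of_mul; apply: mx_eqmodM.
have -> : A = ((A * B^-1) * B)%g by rewrite mulgKV.
by rewrite -[X in mx_eqmod n _ X]mul1mx mx_of_mul; apply: mx_eqmodM.
Qed.

Lemma ker_mod_dvd m n A : (0 < n)%N -> (m %| n)%N -> ker_mod n A -> ker_mod m A.
Proof. exact: mx_eqmod_dvd. Qed.

Lemma SL2_subgroup : subgroup_set SL2Zhat.
Proof.
rewrite /SL2Zhat; split=> /= [|A B A1 B1|A A1]; first by rewrite det1.
  by rewrite det_mulmx A1 B1 mulr1.
by rewrite det_inv A1 invr1.
Qed.

Lemma lift_SL2 n (A : GL2Zhat) : zeq n (\det A) 1 ->
  exists2 B, SL2Zhat B & mx_eqmod n B A.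
Proof.
move=> A1; have uA := det_gl2_unit A.
have [D DE] : exists D : GL2Zhat, mx_of D = mx2 (\det A)^-1 0 0 1.
  by apply: exists_gl2; rewrite det_mx2 !mx2E mulr1 mulr0 subr0 unitrV.
exists (D * A)%g.
  rewrite /SL2Zhat /= det_mulmx DE [X in X * _]det_mx2 !mx2E.
  by rewrite mulr1 mulr0 subr0 mulVr.
rewrite mx_of_mul -[X in mx_eqmod n _ X]mul1mx; apply: mx_eqmodM => //.
rewrite DE mx2_1; apply/mx_eqmodP; rewrite !mx2E; split=> //.
rewrite -[X in zeq _ _ X](mulrV uA) -[X in zeq _ X _]mul1r.
by apply: zeqM => //; apply: zeq_sym.
Qed.

(** The lift is [A] at the primes dividing [n], where its determinant is a unit, and the identity at
    all others. *)
Lemma lift_GL2 n (A : 'M[Zhat]_2) u : (0 < n)%N -> zeq n (\det A * u) 1 ->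
  exists B : GL2Zhat, mx_eqmod n B A.
Proof.
move=> n0 Au; have [e [_ e1 e0]] := exists_idempotent (fun p => p %| n)%N.
have en : zeq n e 1 by apply: e1.
pose B := mx2 (e * A 0 0 + (1 - e)) (e * A 0 1) (e * A 1 0) (e * A 1 1 + (1 - e)).
have BA m : zeq m e 1 -> mx_eqmod m B A.
  move=> em; have H x : zeq m (e * x) x.
    by rewrite -[X in zeq _ _ X]mul1r; apply: zeqM.
  apply/mx_eqmodP; rewrite !mx2E; split=> //; rewrite -[X in zeq _ _ X]addr0;
    by apply: zeqD => //; rewrite -(subrr 1); apply: zeqB.
have [|C CE] := @exists_gl2 B; last by exists C; rewrite CE; apply: BA.
apply/zunitP => p pp B0; have [pn|pn] := boolP (p %| n)%N.
  have ep : zeq p e 1 by apply: zeq_dvd en.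
  have /zeq_sym A0 := zeq_trans (zeq_sym (mx_eqmod_det (BA p ep))) B0.
  have : zeq p (\det A * u) 1 by apply: zeq_dvd Au.
  move/(zeq_trans (zeqM A0 (zeq_refl p u))).
  rewrite mul0r => /zeqE; rewrite zres0 zres1 ?prime_gt0 // modn_small //.
  exact: prime_gt1.
have ep : zeq p e 0.
  apply: e0; first exact: prime_gt0.
  by move=> q qp; rewrite dvdn_prime2 // => /eqP->.
have B1 : mx_eqmod p B 1%:M.
  have H x : zeq p (e * x) 0 by rewrite -[X in zeq _ _ X](mul0r x); apply: zeqM.
  rewrite mx2_1; apply/mx_eqmodP; rewrite !mx2E; split=> //;
    rewrite -[X in zeq _ _ X]add0r; apply: zeqD => //;
    by rewrite -[X in zeq _ _ X]subr0; apply: zeqB.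
have := zeq_trans (zeq_sym (mx_eqmod_det B1)) B0.
rewrite det1 => /zeqE; rewrite zres0 zres1 ?prime_gt0 // modn_small //.
exact: prime_gt1.
Qed.

Lemma zeq_lcm n m x y : (0 < n)%N -> (0 < m)%N ->
  zeq n x y -> zeq m x y -> zeq (lcmn n m) x y.
Proof.
move=> n0 m0 /zeq_sub0/zeqE xn /zeq_sub0/zeqE xm; apply/zeq_sub0/zeqE.
have l0 : (0 < lcmn n m)%N by rewrite lcmn_gt0 n0.
rewrite zres0 in xn xm *; apply/eqP; rewrite -[X in X == _](modn_small (zres_lt _ l0)).
rewrite -/(dvdn _ _) dvdn_lcm /dvdn.
by rewrite -!(zres_dvd _ l0) ?dvdn_lcml ?dvdn_lcmr // xn xm.
Qed.

(** Through [A = (A B^-1) B], the kernels modulo [m] and [n] generate the kernel modulo their gcd.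
    [B] is [A] at the primes where [n] has the smaller valuation, and 1 elsewhere; in each case the
    other congruence holds because the smaller prime power divides the gcd. *)
Lemma gl2_interpolate n m (A : GL2Zhat) : (0 < n)%N -> (0 < m)%N ->
  ker_mod (gcdn n m) A ->
  exists2 B : GL2Zhat, ker_mod n B /\ mx_eqmod m B A & (SL2Zhat A -> SL2Zhat B).
Proof.
move=> n0 m0 A1.
pose pi : pred nat := fun p => (logn p n <= logn p m)%N.
have [e [_ e1 e0]] := exists_idempotent pi.
pose P : nat_pred := [pred p | pi p].
have g0 : (0 < gcdn n m)%N by rewrite gcdn_gt0 n0.
have nP : (n`_P %| gcdn n m)%N.
  rewrite dvdn_gcd dvdn_part /=; apply/dvdn_partP => // p.
  rewrite pi_of_part // => /andP[/= pn piP].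
  have pp : prime p by move: pn; rewrite mem_primes => /and3P[].
  rewrite partn_part; last by move=> q; rewrite inE => /eqP->.
  by rewrite p_part pfactor_dvdn.
have mP : (m`_P^' %| gcdn n m)%N.
  rewrite dvdn_gcd dvdn_part andbT; apply/dvdn_partP => // p.
  rewrite pi_of_part // => /andP[/= pn piP].
  have pp : prime p by move: pn; rewrite mem_primes => /and3P[].
  rewrite partn_part; last by move=> q; rewrite inE => /eqP->.
  by rewrite p_part pfactor_dvdn // ltnW // ltnNge.
have zpart k x y : (0 < k)%N -> zeq k`_P x y -> zeq (k`_P^')%N x y -> zeq k x y.
  move=> k0 /zeqE xy /zeqE xy'; apply/zeqE.
  rewrite !(zres_dvd _ k0 (dvdn_part P k)) in xy.
  rewrite !(zres_dvd _ k0 (dvdn_part (negn P) k)) in xy'.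
  rewrite -(modn_small (zres_lt x k0)) -(modn_small (zres_lt y k0)).
  apply/eqP; rewrite -[X in (_ == _ %[mod X])%N](partnC P k0).
  by rewrite chinese_remainder ?coprime_partC // xy xy' !eqxx.
have eP k : (0 < k)%N -> zeq k`_P e 1.
  by move=> k0; apply: e1 => // p pp pk; apply: (pnatP _ _ (part_pnat P k)).
have eP' k : (0 < k)%N -> zeq (k`_P^')%N e 0.
  by move=> k0; apply: e0 => // p pp pk; apply: (pnatP _ _ (part_pnat (negn P) k)).
have eM k x : zeq k e 1 -> zeq k (e * x) x.
  by move=> ek; rewrite -[X in zeq _ _ X]mul1r; apply: zeqM.
have eM0 k x : zeq k e 0 -> zeq k (e * x) 0.
  by move=> ek; rewrite -[X in zeq _ _ X](mul0r x); apply: zeqM.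
have A1n : mx_eqmod n`_P A 1%:M by apply: mx_eqmod_dvd A1.
have A1m : mx_eqmod (m`_P^')%N A 1%:M by apply: mx_eqmod_dvd A1.
pose B := 1%:M + e *: (mx_of A - 1%:M).
have zB k x y : zeq k e 1 -> zeq k (x + e * (y - x)) y.
  by move=> ek; rewrite -[X in zeq _ _ X](subrKC x); apply: zeqD => //; apply: eM.
have zB0 k x y : zeq k e 0 -> zeq k (x + e * y) x.
  by move=> ek; rewrite -[X in zeq _ _ X]addr0; apply: zeqD => //; apply: eM0.
have zB1 k x y : zeq k y x -> zeq k (x + e * (y - x)) x.
  move=> yx; rewrite -[X in zeq _ _ X]addr0; apply: zeqD => //.
  by rewrite -(mulr0 e); apply: zeqM => //; apply/zeq_sub0.
have BE i j : B i j = 1%:M i j + e * (A i j - 1%:M i j) by rewrite !mxE.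
have Bn : mx_eqmod n B 1%:M.
  move=> i j; apply: zpart; rewrite // BE; first exact: zB1.
  by apply: zB0; apply: eP'.
have Bm : mx_eqmod m B A.
  move=> i j; apply: zpart; rewrite // BE; first by apply: zB; apply: eP.
  by apply: zeq_trans (zeq_sym (A1m i j)); apply: zB0; apply: eP'.
have [|C CE] := @exists_gl2 B.
  apply/zunitP => p pp; have p0 := prime_gt0 pp; have [pip|pip] := boolP (pi p).
    have ep : zeq p e 1.
      by apply: e1 => // q qp; rewrite dvdn_prime2 // => /eqP->.
    have /mx_eqmod_det BA : mx_eqmod p B A by move=> i j; rewrite BE; apply: zB.
    move=> /(zeq_trans (zeq_sym BA)).
    by apply: (proj1 (zunitP _)) => //; apply: det_gl2_unit.
  have ep : zeq p e 0.
    by apply: e0 => // q qp; rewrite dvdn_prime2 // => /eqP->.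
  have /mx_eqmod_det BA : mx_eqmod p B 1%:M by move=> i j; rewrite BE; apply: zB0.
  move=> /(zeq_trans (zeq_sym BA)); rewrite det1.
  by apply: (proj1 (zunitP _)) => //; apply: unitr1.
have [AS|nAS] := pselect (SL2Zhat A); last first.
  by exists C => [|/nAS//]; rewrite /ker_mod /= CE.
(* The determinant of [C] is 1 modulo [n] and modulo [m], so it can be corrected without changing
   [C] modulo either. *)
have [] := @lift_SL2 (lcmn n m) C.
  rewrite CE; apply: zeq_lcm => //.
    by rewrite -[X in zeq _ _ X](det1 _ 2); apply: mx_eqmod_det.
  by rewrite -AS; apply: mx_eqmod_det.
move=> D SD DC; exists D => //.
have nm0 : (0 < lcmn n m)%N by rewrite lcmn_gt0 n0.
split; last first.
  apply: mx_eqmod_trans Bm; rewrite -CE.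
  by apply: (mx_eqmod_dvd nm0) DC; apply: dvdn_lcmr.
apply: mx_eqmod_trans Bn; rewrite -CE.
by apply: (mx_eqmod_dvd nm0) DC; apply: dvdn_lcml.
Qed.

(** By interpolation the gcd of the level and [M] is again an admissible modulus; minimality makes
    it equal to the level. *)
Lemma level_spec K H M : K = setT \/ K = SL2Zhat -> subgroup_set H ->
  (0 < M)%N -> K `&` ker_mod M `<=` H ->
  [/\ (0 < level K H)%N, K `&` ker_mod (level K H) `<=` H & (level K H %| M)%N].
Proof.
move=> KE [H1 HM HV] M0 HK.
pose P n := `[< (0 < n)%N /\ K `&` ker_mod n `<=` H >].
have exP : exists n, P n by exists M; apply/asboolP.
have [l0 lK lmin] : [/\ (0 < level K H)%N, K `&` ker_mod (level K H) `<=` H &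
    forall m : nat, (0 < m)%N -> K `&` ker_mod m `<=` H -> (level K H <= m)%N].
  rewrite /level; case: xgetP => [n _ //|/(_ (ex_minn exP)) []].
  case: ex_minnP => n /asboolP[n0 nK] nmin; split=> // m m0 mK.
  by apply: nmin; apply/asboolP.
split=> //; set l := level K H in l0 lK lmin *.
have g0 : (0 < gcdn l M)%N by rewrite gcdn_gt0 l0.
suff /lmin -/(_ g0) : K `&` ker_mod (gcdn l M) `<=` H.
  move=> lg; have /eqP <- : gcdn l M == l; last exact: dvdn_gcdr.
  by rewrite eqn_leq lg dvdn_leq ?dvdn_gcdl.
move=> A [KA gA]; have [B [Bl BM] BS] := gl2_interpolate l0 M0 gA.
have KM C D : K C -> K D -> K (C * D)%g.
  by case: KE => -> //; have [_ + _] := SL2_subgroup; apply.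
have KV C : K C -> K (C^-1)%g.
  by case: KE => -> //; have [_ _] := SL2_subgroup; apply.
have KB : K B by case: KE KA => -> //.
have -> : A = ((A * B^-1) * B)%g by rewrite mulgKV.
apply: HM; last exact: lK.
apply: HK; split; first by apply: KM => //; apply: KV.
by apply/ker_modE; apply: mx_eqmod_sym.
Qed.

(** * Elementary matrices and commutators *)

Definition has_commutators (G H : set GL2Zhat) : Prop :=
  forall A B, G A -> G B -> H [~ A, B]%g.

Lemma zeq_unit1 p : prime p -> ~ zeq p 1 0.
Proof. by move=> pp; apply: (proj1 (zunitP 1)) => //; apply: unitr1. Qed.

Lemma exists_unitriangular x : exists U L : GL2Zhat,
  mx_of U = mx2 1 x 0 1 /\ mx_of L = mx2 1 0 x 1.
Proof.
have [|U UE] := @exists_gl2 (mx2 1 x 0 1).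
  by rewrite det_mx2 !mx2E mulr1 mulr0 subr0 unitr1.
have [|L LE] := @exists_gl2 (mx2 1 0 x 1).
  by rewrite det_mx2 !mx2E mulr1 mul0r subr0 unitr1.
by exists U, L.
Qed.

(* [t] is 1 at the primes where [A 0 0] is not a unit and 0 elsewhere, so that
   [a = A 0 0 + t * A 1 0] is a unit everywhere. *)
Lemma SL2_ker_elementary (H : set GL2Zhat) m : (0 < m)%N -> subgroup_set H ->
  (forall z (A : GL2Zhat), mx_of A = mx2 1 (m%:R * z) 0 1 -> H A) ->
  (forall z (A : GL2Zhat), mx_of A = mx2 1 0 (m%:R * z) 1 -> H A) ->
  SL2Zhat `&` ker_mod (m ^ 2) `<=` H.
Proof.
move=> m0 [H1 HM HV] HU HL A [SA KA].
have mm0 : (0 < m ^ 2)%N by rewrite expn_gt0 m0.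
move: (KA); rewrite /ker_mod /= mx2_1 => /mx_eqmodP; rewrite !mx2E => -[a1 b0 c0 d1].
have detA : A 0 0 * A 1 1 - A 0 1 * A 1 0 = 1 by rewrite -det_mx2.
have [t [_ t1 t0]] := exists_idempotent (fun p => `[< zeq p (A 0 0) 0 >]).
have tm : zeq (m ^ 2) t 0.
  apply: t0 => // p pp pm; apply/asboolP => pa; apply: (zeq_unit1 pp).
  by apply: zeq_trans pa; apply: zeq_sym; apply: zeq_dvd a1.
pose a := A 0 0 + t * A 1 0; pose b := A 0 1 + t * A 1 1.
have ua : a \is a GRing.unit.
  apply/zunitP => p pp; have p0 := prime_gt0 pp; rewrite /a.
  have [pa|pa] := boolP `[< zeq p (A 0 0) 0 >]; last first.
    have tp : zeq p t 0.
      by apply: t0 => // q qp; rewrite dvdn_prime2 // => /eqP->.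
    move=> ac; move/asboolP: pa; apply; apply: zeq_trans ac.
    rewrite -[X in zeq _ X _]addr0; apply: zeqD => //.
    by rewrite -(mul0r (A 1 0)); apply: zeqM => //; apply: zeq_sym.
  have tp : zeq p t 1.
    by apply: t1 => // q qp; rewrite dvdn_prime2 // => /eqP->.
  move/asboolP: pa => pa ac; apply: (zeq_unit1 pp).
  have pc : zeq p (A 1 0) 0.
    apply: zeq_trans ac; apply: zeq_sym; rewrite -[X in zeq _ _ X]add0r.
    by apply: zeqD => //; rewrite -[X in zeq _ _ X]mul1r; apply: zeqM.
  rewrite -detA -(subrr (0 : Zhat)); apply: zeqB.
    by rewrite -(mul0r (A 1 1)); apply: zeqM.
  by rewrite -(mulr0 (A 0 1)); apply: zeqM.
have am : zeq (m ^ 2) (a - 1) 0.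
  apply/zeq_sub0; rewrite -[X in zeq _ _ X]addr0; apply: zeqD => //.
  by rewrite -(mul0r (A 1 0)); apply: zeqM.
have bm : zeq (m ^ 2) b 0.
  rewrite -[X in zeq _ _ X]addr0; apply: zeqD => //.
  by rewrite -(mul0r (A 1 1)); apply: zeqM.
have mult x : zeq (m ^ 2) x 0 -> exists z, x = m%:R * (m%:R * z).
  by case/(zeq_multiple mm0) => z ->; exists z; rewrite mulrA -natrM.
have [z az] := mult _ am; have [c' cz] := mult _ c0.
have [b' bz] := mult _ bm; have [t' tz] := mult _ tm.
pose y := m%:R * z; pose s := (A 1 0 - y) / a; pose r := (b - m%:R) / a.
have [U1 [_ [U1E _]]] := exists_unitriangular (- t).
have [_ [L1 [_ L1E]]] := exists_unitriangular s.
have [U2 [_ [U2E _]]] := exists_unitriangular m%:R.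
have [_ [L2 [_ L2E]]] := exists_unitriangular y.
have [U3 [_ [U3E _]]] := exists_unitriangular r.
(* [U2 * L2] has determinant 1 and top-left entry [1 + m * y = a], with [y] a multiple of [m]: this
   is why a congruence modulo [m ^ 2] is assumed. As [a] is a unit, [L1] and [U3] adjust the two
   off-diagonal entries, the determinant forces the last one, and [U1] undoes the passage from
   [A 0 0] to [a]. *)
have -> : A = (U1 * (L1 * (U2 * L2) * U3))%g.
  apply: val_inj; rewrite /= U1E L1E U2E L2E U3E [LHS]mx2_eta.
  have sa : s * a = A 1 0 - y by rewrite /s divrK.
  have ra : a * r = b - m%:R by rewrite /r mulrC divrK.
  have aE : a = 1 + m%:R * y by rewrite /y -az; ring.
  have ad : a * A 1 1 = 1 + b * A 1 0 by rewrite -detA /a /b; ring.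
  have e11 : A 1 0 * r + (s * m%:R + 1) = A 1 1.
    apply: (mulrI ua); rewrite ad.
    have -> : a * (A 1 0 * r + (s * m%:R + 1)) =
       A 1 0 * (a * r) + (s * a) * m%:R + a by ring.
    by rewrite sa ra [X in _ + X]aE; ring.
  have -> : mx2 1 m%:R 0 1 *m mx2 1 0 y 1 = mx2 a m%:R y 1.
    by rewrite mulmx2 aE; congr mx2; ring.
  have -> : mx2 1 0 s 1 *m mx2 a m%:R y 1 = mx2 a m%:R (A 1 0) (s * m%:R + 1).
    by rewrite mulmx2 sa; congr mx2; ring.
  have -> : mx2 a m%:R (A 1 0) (s * m%:R + 1) *m mx2 1 r 0 1 =
      mx2 a b (A 1 0) (A 1 1).
    by rewrite mulmx2 ra !mulr1 e11; congr mx2; ring.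
  by rewrite mulmx2 /a /b; congr mx2; ring.
apply: (HM U1).
  by apply: (HU (- (m%:R * t'))); rewrite U1E tz mulrN.
apply: (HM (L1 * (U2 * L2))%g); last first.
  apply: (HU ((m%:R * b' - 1) / a)); rewrite U3E /r bz; congr mx2; ring.
apply: (HM L1).
  apply: (HL ((m%:R * c' - z) / a)); rewrite L1E /s cz /y; congr mx2; ring.
apply: (HM U2); first by apply: (HU 1); rewrite U2E mulr1.
exact: (HL z).
Qed.

Lemma commutator_elementary n (G H : set GL2Zhat) : (0 < n)%N ->
  ker_mod n `<=` G -> has_commutators G H -> forall z (A : GL2Zhat),
  mx_of A = mx2 1 ((2 * n ^ 2)%:R * z) 0 1 \/
  mx_of A = mx2 1 0 ((2 * n ^ 2)%:R * z) 1 -> H A.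
Proof.
move=> n0 KG HC z A AE.
have [e [ee e1 e0]] := exists_idempotent (fun p => p %| n)%N.
have en : zeq n e 1 by apply: e1.
(* [a] is [1 + n] at the primes dividing [n] and [- 1] elsewhere: a unit congruent
   to 1 modulo [n] such that [a - 1] divides [2 * n]. *)
pose a := e * (1 + n%:R) - (1 - e).
have an : zeq n a 1.
  rewrite -[X in zeq _ _ X]subr0; apply: zeqB.
    rewrite -[X in zeq _ _ X]mulr1; apply: zeqM => //.
    by rewrite -[X in zeq _ _ X]addr0; apply: zeqD => //; apply: zeq_natr.
  by rewrite -(subrr 1); apply: zeqB.
have ua : a \is a GRing.unit.
  apply/zunitP => p pp; have p0 := prime_gt0 pp.
  have [pn|pn] := boolP (p %| n)%N.
    move=> a0; apply: (zeq_unit1 pp); apply: zeq_trans a0.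
    by apply: zeq_sym; apply: zeq_dvd an.
  have ep : zeq p e 0.
    by apply: e0 => // q qp; rewrite dvdn_prime2 // => /eqP->.
  have ap : zeq p a (- 1).
    rewrite -[X in zeq _ _ X]add0r; apply: zeqD.
      by rewrite -(mul0r (1 + n%:R)); apply: zeqM.
    by apply: zeqN; rewrite -[X in zeq _ _ X]subr0; apply: zeqB.
  move/(zeq_trans (zeq_sym ap))/zeqN; rewrite opprK oppr0; exact: zeq_unit1.
(* [a - 1] is [n] at the primes dividing [n] and [- 2] elsewhere, with cofactors [2] and [- n] in
   [2 * n]. *)
pose k := 2%:R * e - n%:R * (1 - e).
have ak : (a - 1) * k = (2 * n)%:R.
  rewrite natrM /a /k.
  have -> : (e * (1 + n%:R) - (1 - e) - 1) * (2%:R * e - n%:R * (1 - e)) =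
    2%:R * n%:R + (e * e - e) * (n%:R * n%:R + 4%:R * n%:R + 4%:R) :> Zhat by ring.
  by rewrite ee subrr mul0r addr0.
(* The commutator of [diag(a, 1)] with the upper unitriangular matrix of entry [x] has entry
   [(a - 1) x / a]; the factor [a] in [x] cancels the denominator. *)
pose x := n%:R * (k * z * a).
have xa : x * (a - 1) = a * ((2 * n ^ 2)%:R * z).
  have -> : x * (a - 1) = n%:R * ((a - 1) * k) * z * a by rewrite /x; ring.
  by rewrite ak -natrM; rewrite (mulnCA n 2 n) mulnn; ring.
have xn : zeq n x 0.
  by rewrite -(mul0r (k * z * a)); apply: zeqM => //; apply: zeq_natr.
have [U [L [UE LE]]] := exists_unitriangular x.
have [|D DE] := @exists_gl2 (mx2 a 0 0 1).
  by rewrite det_mx2 !mx2E mulr1 mul0r subr0.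
have [|D' DE'] := @exists_gl2 (mx2 1 0 0 a).
  by rewrite det_mx2 !mx2E mul1r mul0r subr0.
have GD : G D.
  by apply: KG; rewrite /ker_mod /= DE mx2_1; apply/mx_eqmodP; rewrite !mx2E.
have GD' : G D'.
  by apply: KG; rewrite /ker_mod /= DE' mx2_1; apply/mx_eqmodP; rewrite !mx2E.
have GU : G U.
  by apply: KG; rewrite /ker_mod /= UE mx2_1; apply/mx_eqmodP; rewrite !mx2E.
have GL : G L.
  by apply: KG; rewrite /ker_mod /= LE mx2_1; apply/mx_eqmodP; rewrite !mx2E.
case: AE => AE.
  suff -> : A = [~ D, U]%g by apply: HC.
  apply: (mulgI (U * D)%g); rewrite -commgC; apply: val_inj.
  rewrite /= DE UE AE !mulmx2.
  have -> : a * x + 0 * 1 = x * (a - 1) + x by ring.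
  by rewrite xa; congr mx2; ring.
suff -> : A = [~ D', L]%g by apply: HC.
apply: (mulgI (L * D')%g); rewrite -commgC; apply: val_inj.
rewrite /= DE' LE AE !mulmx2.
have -> : 0 * 1 + a * x = x * (a - 1) + x by ring.
by rewrite xa; congr mx2; ring.
Qed.

Lemma SL2_ker_commutators n (G H : set GL2Zhat) : (0 < n)%N ->
  ker_mod n `<=` G -> subgroup_set H -> has_commutators G H ->
  SL2Zhat `&` ker_mod (4 * n ^ 4) `<=` H.
Proof.
move=> n0 KG sH HC.
have -> : (4 * n ^ 4 = (2 * n ^ 2) ^ 2)%N by rewrite expnMn -expnM.
apply: SL2_ker_elementary => //; first by rewrite muln_gt0 expn_gt0 n0.
  by move=> z A AE; apply: (commutator_elementary n0 KG HC); left; apply: AE.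
by move=> z A AE; apply: (commutator_elementary n0 KG HC); right; apply: AE.
Qed.

(** * The groups G_W *)

Lemma expn_gcd_mod N a x y :
  (0 < x)%N -> (a ^ x = 1 %[mod N])%N -> (a ^ y = 1 %[mod N])%N ->
  (a ^ gcdn x y = 1 %[mod N])%N.
Proof.
move=> x0 ax ay; have [u v uv _] := egcdnP y x0.
have H z w : (a ^ z = 1 %[mod N])%N -> (a ^ (w * z) = 1 %[mod N])%N.
  by move=> az; rewrite mulnC expnM -modnXm az modnXm exp1n.
by have := H _ u ax; rewrite uv expnD -modnMml (H _ v ay) modnMml mul1n.
Qed.

(* The 2-part of the exponent of [(Z/N)^*] is at most [totient N < 2 ^ N]. *)
Lemma unit_pow2_mod N v : (0 < N)%N -> v \is a GRing.unit ->
  zeq N (v ^+ (2 ^ N.+1)) 1 -> zeq N (v ^+ (2 ^ N)) 1.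
Proof.
move=> N0 uv /zeqE; rewrite zresX // zres1 // => vN.
apply/zeqE; rewrite zresX // zres1 //.
have co := zunit_coprime N0 uv.
have t0 : (0 < totient N)%N by rewrite totient_gt0.
have := expn_gcd_mod t0 (Euler_exp_totient co) vN.
have /(dvdn_pfactor _ _ (isT : prime 2)) [i _ iE] :=
  dvdn_gcdr (totient N) (2 ^ N.+1).
rewrite iE => ai; have iN : (i <= N)%N.
  apply: ltnW; rewrite -(ltn_exp2l i N (isT : 1 < 2)%N) -iE.
  apply: leq_ltn_trans (dvdn_leq t0 (dvdn_gcdl _ _)) _.
  apply: leq_ltn_trans (ltn_expl N (isT : 1 < 2)%N).
  rewrite totient_count_coprime big_mkord -[X in (_ <= X)%N]card_ord -sum1_card.
  by apply: leq_sum => j _; apply: leq_b1.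
by rewrite -[X in (_ ^ (2 ^ X))%N](subnKC iN) expnD expnM -modnXm ai modnXm exp1n.
Qed.

Definition lift_subgroup N (W : set GL2Zhat) : set GL2Zhat :=
  [set A | exists B v, [/\ W B, v \is a GRing.unit &
                           mx_eqmod N A (v ^+ (2 ^ N) *: mx_of B)]].

Lemma mx_eqmodZ n (a b : Zhat) (A B : 'M[Zhat]_2) :
  zeq n a b -> mx_eqmod n A B -> mx_eqmod n (a *: A) (b *: B).
Proof. by move=> ab AB i j; rewrite !mxE; apply: zeqM => //; apply: AB. Qed.

Lemma exists_scalar (v : Zhat) : v \is a GRing.unit ->
  exists S : GL2Zhat, mx_of S = v%:M.
Proof.
by move=> uv; apply: exists_gl2; rewrite det_scalar unitrX.
Qed.

Section Lift.
Variables (N : nat) (W : set GL2Zhat).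
Hypotheses (N0 : (0 < N)%N) (sW : subgroup_set W).

Lemma lift_subgroup_subgroup : subgroup_set (lift_subgroup N W).
Proof.
case: sW => W1 WM WV; split.
- by exists 1%g, 1; rewrite unitr1 expr1n scale1r.
- move=> A B [A' [v [WA uv AE]]] [B' [u [WB uu BE]]].
  exists (A' * B')%g, (v * u); rewrite unitrM uv uu; split=> //; first exact: WM.
  have -> : (v * u) ^+ (2 ^ N) *: mx_of (A' * B')%g =
      (v ^+ (2 ^ N) *: mx_of A') *m (u ^+ (2 ^ N) *: mx_of B').
    by rewrite mx_of_mul -scalemxAl -scalemxAr scalerA exprMn.
  exact: mx_eqmodM.
- move=> A [A' [v [WA uv AE]]].
  have [S SE] : exists S : GL2Zhat, mx_of S = (v ^+ (2 ^ N))%:M.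
    by apply: exists_scalar; rewrite unitrX.
  exists (A'^-1)%g, v^-1; rewrite unitrV uv; split=> //; first exact: WV.
  have AS : mx_eqmod N A (S * A')%g by rewrite mx_of_mul SE mul_scalar_mx.
  have -> : v^-1 ^+ (2 ^ N) *: mx_of (A'^-1)%g = mx_of (S * A')^-1%g.
    rewrite invgM mx_of_mul /=.
    have -> : invmx (mx_of S) = (v^-1 ^+ (2 ^ N))%:M.
      by rewrite SE invmx_scalar exprVn.
    by rewrite mul_mx_scalar.
  have -> : A^-1%g = (A^-1 * ((S * A') * (S * A')^-1))%g by rewrite mulgV mulg1.
  apply: mx_eqmod_sym; rewrite mulgA.
  rewrite -[X in mx_eqmod N X _]mul1mx mx_of_mul; apply: mx_eqmodM => //.
  by rewrite -mx_of_1 -(mulVg A) !mx_of_mul; apply: mx_eqmodM.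
Qed.

Lemma lift_subgroup_ker : ker_mod N `<=` lift_subgroup N W.
Proof.
by case: sW => W1 _ _ A KA; exists 1%g, 1; rewrite unitr1 expr1n scale1r.
Qed.

Lemma lift_subgroup_SL2 : W `<=` SL2Zhat -> SL2Zhat `&` ker_mod N `<=` W ->
  lift_subgroup N W `&` SL2Zhat = W.
Proof.
case: sW => W1 WM WV WS KW; apply/seteqP; split=> A; last first.
  move=> WA; split; last exact: WS.
  by exists A, 1; rewrite unitr1 expr1n scale1r.
case=> -[B [v [WB uv AE]]] SA.
have vN : zeq N (v ^+ (2 ^ N)) 1.
  apply: unit_pow2_mod => //; apply: zeq_sym.
  have := mx_eqmod_det AE; rewrite detZ (WS B WB) SA mulr1 -exprM.
  by rewrite -expnSr.
have AB : mx_eqmod N A B.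
  apply: mx_eqmod_trans AE _; rewrite -[X in mx_eqmod _ _ X]scale1r.
  exact: mx_eqmodZ.
have -> : A = (A * B^-1 * B)%g by rewrite mulgKV.
apply: WM => //; apply: KW; split; last exact/ker_modE.
have [_ SM SV] := SL2_subgroup; apply: SM => //.
by apply: SV; apply: WS.
Qed.

Lemma lift_subgroup_sub (G : set GL2Zhat) : subgroup_set G -> W `<=` G ->
  (forall (A : GL2Zhat) (u : Zhat), mx_of A = u%:M -> G A) ->
  ker_mod N `<=` G -> lift_subgroup N W `<=` G.
Proof.
case=> _ GM GV WG GS KG A [B [v [WB uv AE]]].
have [S SE] : exists S : GL2Zhat, mx_of S = (v ^+ (2 ^ N))%:M.
  by apply: exists_scalar; rewrite unitrX.
have -> : A = (A * (S * B)^-1 * (S * B))%g by rewrite mulgKV.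
apply: (GM); last by apply: GM; [apply: GS SE | apply: WG].
by apply/KG/ker_modE; rewrite mx_of_mul SE mul_scalar_mx.
Qed.
End Lift.

(** * Open subgroups and cosets of units *)

Lemma open_subgroup (G : set GL2Zhat) n : (0 < n)%N -> subgroup_set G ->
  ker_mod n `<=` G -> open G.
Proof.
move=> n0 [_ GM _] KG; suff : gl2_open G by [].
move=> A GA; exists n => // B AB.
have -> : B = (B * A^-1 * A)%g by rewrite mulgKV.
by apply: GM => //; apply/KG/ker_modE; apply: mx_eqmod_sym.
Qed.

Lemma open_ker (G : set GL2Zhat) : subgroup_set G -> open G ->
  exists2 n, (0 < n)%N & ker_mod n `<=` G.
Proof.
move=> [G1 _ _] oG; have [n n0 nG] := (oG : gl2_open G) _ G1.
by exists n => // A KA; apply: nG; apply: mx_eqmod_sym.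
Qed.

Lemma lift_unit n k : (0 < n)%N -> coprime k n ->
  exists2 u : Zhat, u \is a GRing.unit & zeq n u k%:R.
Proof.
move=> n0 co; have : (k %| chinese n k 1 0)%N.
  by rewrite /dvdn chinese_modr 1?coprime_sym // mod0n.
case/dvdnP=> w wE.
(* A unit is lifted as the determinant of a lifted matrix. *)
have dE : \det (mx2 k%:R 0 0 1 : 'M[Zhat]_2) = k%:R.
  by rewrite det_mx2 !mx2E mulr1 mul0r subr0.
have [|B BE] := @lift_GL2 n (mx2 k%:R 0 0 1) w%:R n0.
  rewrite dE -natrM mulnC -wE; apply/zeqE.
  by rewrite zres_nat // zres1 // chinese_modl // coprime_sym.
exists (\det B); first exact: det_gl2_unit.
by rewrite -dE; apply: mx_eqmod_det.
Qed.

(** [D] is a union of classes modulo [N] within the units, so its cosets are counted in a finite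
    unit group; the quotient there is killed by [2 ^ k], and by Cauchy's theorem it is a 2-group. *)
Lemma unit_cosets_pow2 (D : set Zhat) N k : (0 < N)%N ->
  D 1 -> (forall x y, D x -> D y -> D (x * y)) ->
  (forall x, D x -> x \is a GRing.unit) ->
  (forall x, x \is a GRing.unit -> zeq N x 1 -> D x) ->
  (forall x, x \is a GRing.unit -> D (x ^+ (2 ^ k))) ->
  exists k, (unit_cosets D #= `I_(2 ^ k)%N)%card.
Proof.
move=> N0 D1 DM DU DN D2.
(* Doubling covers [N = 1]: the type ['Z_M] is the ring of residues modulo [M] only for [M > 1]. *)
pose M := (2 * N)%N; have M1 : (1 < M)%N by rewrite /M; lia.
have M0 : (0 < M)%N by apply: ltnW.
pose red (x : Zhat) : 'Z_M := inZp (zres x M).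
have redE x : red x = zres x M :> nat by rewrite /= Zp_cast // modn_small ?zres_lt.
have redP x y : red x = red y <-> zeq M x y.
  rewrite zeqE -!redE; split=> [->//|]; exact: val_inj.
have redM x y : red (x * y) = red x * red y.
  have vM (a b : 'Z_M) : a * b = (a * b %% M)%N :> nat by rewrite /= {3}Zp_cast.
  by apply: ord_inj; rewrite vM !redE zresM.
have red1 : red 1 = 1.
  by apply: ord_inj; rewrite redE zres1 //= Zp_cast.
have redU x : x \is a GRing.unit -> red x \is a GRing.unit.
  by move=> ux; apply/unitrPr; exists (red x^-1); rewrite -redM mulrV.
pose gT := {unit 'Z_M}.
have liftU (g : gT) : exists2 u : Zhat, u \is a GRing.unit & red u = val g.
  have co : coprime (val g : 'Z_M) M.
    by have := valP g; rewrite /= -{1}[val g]natr_Zp unitZpE // coprime_sym.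
  have [u uu uE] := lift_unit M0 co; exists u => //.
  move/zeqE: uE; rewrite zres_nat // => uE; apply: ord_inj.
  rewrite redE uE modn_small //; have := ltn_ord (val g).
  by rewrite [X in (_ < X)%N]Zp_cast.
pose S := [set g : gT | `[< exists2 d, D d & red d = val g >]]%SET.
have SP g : reflect (exists2 d, D d & red d = val g) (g \in S).
  by rewrite inE; apply: asboolP.
have gS : group_set S.
  apply/group_setP; split; first by apply/SP; exists 1.
  move=> x y /SP[d Dd dx] /SP[d' Dd' dy]; apply/SP; exists (d * d').
    exact: DM.
  by rewrite redM dx dy.
pose SG := Group gS.
pose F (C : {set gT}) : set Zhat :=
  [set u | u \is a GRing.unit /\ exists2 g, g \in C & red u = val g].
have Finj : injective F.
  have H (C C' : {set gT}) : F C `<=` F C' -> C \subset C'.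
    move=> FC; apply/fintype.subsetP => g gC; have [u uu ug] := liftU g.
    have [_ [g' g'C]] : F C' u by apply: FC; split=> //; exists g.
    by rewrite ug => /val_inj ->.
  move=> C C' CC; apply/eqP; rewrite finset.eqEsubset.
  by apply/andP; split; apply: H; rewrite CC.
pose T := [set: gT]%G.
pose R := rcosets SG T.
have Fcoset u (g : gT) : u \is a GRing.unit -> red u = val g ->
    [set u * d | d in D] = F (SG :* g)%g.
  move=> uu ug; apply/seteqP; split=> [_ [d Dd <-]|w].

    split; first by rewrite unitrM uu DU.
    pose s : gT := FinRing.Unit (redU _ (DU _ Dd)).
    exists (s * g)%g; last by rewrite redM ug mulrC.
    by apply/rcosetP; exists s => //; apply/SP; exists d.
  case=> uw [h /rcosetP[s /SP[d Dd ds] ->] wh].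
  (* The correcting factor [w / (u * d)] is 1 modulo [N], hence lies in [D]. *)
  have ud := DU _ Dd; exists (d * (w / (u * d))); last first.
    by rewrite mulrA mulrCA mulrV ?mulr1 // unitrM uu.
  apply: DM => //; apply: DN.
    by rewrite unitrM uw unitrV unitrM uu.
  have /redP : red w = red (u * d) by rewrite wh FinRing.val_unitM redM ug ds mulrC.
  move=> wud; have {}wud : zeq N w (u * d).
    by apply: zeq_dvd wud => //; apply: dvdn_mull.
  rewrite -[X in zeq _ _ X](@mulrV _ (u * d)) ?unitrM ?uu //.
  by apply: zeqM.
have RE : unit_cosets D = (fun i => F (nth finset.set0 (enum R) i)) @` `I_#|R|.
  apply/seteqP; split=> [_ [u /= uu <-]|_ [i /= iR <-]].
    pose g : gT := FinRing.Unit (redU _ uu).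
    have gR : (SG :* g)%g \in enum R.
      by rewrite mem_enum; apply/rcosetsP; exists g; rewrite ?inE.
    exists (index (SG :* g)%g (enum R)); first by rewrite /= cardE index_mem.
    by rewrite nth_index // (Fcoset u g).
  have : nth finset.set0 (enum R) i \in R by rewrite -mem_enum mem_nth // -cardE.
  case/rcosetsP => g _ ->; have [u uu ug] := liftU g.
  by exists u => //; rewrite (Fcoset u g).
have cR : (unit_cosets D #= `I_#|R|)%card.
  rewrite RE; apply: inj_card_eq => i j /set_mem/= iR /set_mem/= jR /Finj /eqP.
  by rewrite nth_uniq -?cardE ?enum_uniq // => /eqP.
suff [j jE] : exists j, #|R| = (2 ^ j)%N by exists j; rewrite -jE.
have abT : abelian T by apply/centsP => x _ y _; apply: val_inj; rewrite /= mulrC.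
have nS : normal SG T by rewrite -sub_abelian_normal // finset.subsetT.
have pg : (2.-group (T / SG))%g.
  apply/pgroupP => p pp /(Cauchy pp)[x]; case/morphimP => y ny _ -> yp.
  have : (coset SG y ^+ (2 ^ k) = 1)%g.
    rewrite -morphX //; apply: coset_id; have [u uu uy] := liftU y.
    apply/SP; exists (u ^+ (2 ^ k)); first exact: D2.
    elim: (2 ^ k)%N => [|i IH]; first by rewrite red1.
    by rewrite exprS redM IH expgS uy.
  move/eqP; rewrite -order_dvdn yp Euclid_dvdX // dvdn_prime2 //.
  by case/andP.
have [j jE] := p_natP pg; exists j.
by rewrite -jE card_quotient // normal_norm.
Qed.

(** * Correctness of the search *)

Definition mx_code L (A : 'M[Zhat]_2) : nat :=
  enc L (zres (A 0 0) L) (zres (A 0 1) L) (zres (A 1 0) L) (zres (A 1 1) L).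

Definition code_mx L x : 'M[Zhat]_2 :=
  mx2 (ent L 0 x)%:R (ent L 1 x)%:R (ent L 2 x)%:R (ent L 3 x)%:R.

Lemma nat_mxE a b c d : nat_mx (a, b, c, d) = mx2 a%:R b%:R c%:R d%:R.
Proof. by apply/matrixP; apply: ord2P; apply: ord2P; rewrite !mxE. Qed.

Section MatrixCodes.
Variable L : nat.
Hypothesis L0 : (0 < L)%N.

Lemma mx_code_lt A : (mx_code L A < L ^ 4)%N.
Proof. exact: enc_lt. Qed.

Lemma ent_mx_code A :
  ((ent L 0 (mx_code L A) = zres (A 0 0) L)
   * (ent L 1 (mx_code L A) = zres (A 0 1) L)
   * (ent L 2 (mx_code L A) = zres (A 1 0) L)
   * (ent L 3 (mx_code L A) = zres (A 1 1) L))%type.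
Proof.
rewrite /mx_code.
have [-> -> -> ->] := ent_enc (zres (A 0 0) L) (zres (A 0 1) L)
  (zres (A 1 0) L) (zres (A 1 1) L) L0.
by rewrite !modn_small ?zres_lt.
Qed.

Lemma mx_codeP A B : mx_code L A = mx_code L B <-> mx_eqmod L A B.
Proof.
split=> [AB|/mx_eqmodP[/zeqE a /zeqE b /zeqE c /zeqE d]]; last first.
  by rewrite /mx_code a b c d.
by apply/mx_eqmodP; split; apply/zeqE; have := ent_mx_code A;
  rewrite AB !ent_mx_code => -[[[? ?] ?] ?].
Qed.

Lemma code_mxK x : (x < L ^ 4)%N -> mx_code L (code_mx L x) = x.
Proof.
move=> xL; rewrite /mx_code /code_mx !mx2E !zres_nat //.
by rewrite -[RHS](enc_ent L0 xL) /enc !modn_mod.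
Qed.

Lemma zeq_mod x y : zeq L x y <-> (zres x L = zres y L %[mod L])%N.
Proof. by rewrite zeqE !modn_small ?zres_lt. Qed.

Lemma mx_codeM A B : mx_code L (A *m B) = mulc L (mx_code L A) (mx_code L B).
Proof.
rewrite [A in LHS]mx2_eta [B in LHS]mx2_eta mulmx2 /mulc !ent_mx_code /mx_code !mx2E.
by rewrite !zresD // !zresM // !modnDm /enc !modn_mod.
Qed.

Lemma mx_code1 : mx_code L 1%:M = onec L.
Proof. by rewrite mx2_1 /mx_code !mx2E zres0 zres1 // /onec /enc !modn_mod. Qed.

Lemma eqcP m c A B : (m %| L)%N ->
  reflect (mx_eqmod m A (c%:R *: B)) (eqc m L c (mx_code L A) (mx_code L B)).
Proof.
move=> mL; have m0 := dvdn_gt0 L0 mL.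
have H x y : (zres x L == c * zres y L %[mod m])%N <-> zeq m x (c%:R * y).
  rewrite zeqE zresM // zres_nat // !(zres_dvd _ L0 mL) modnMm.
  by split=> /eqP.
rewrite /eqc !ent_mx_code; apply: (iffP and4P) => [[/H ? /H ? /H ? /H ?]|].
  by apply/mx_eqmodP; rewrite !mxE.
by move/mx_eqmodP; rewrite !mxE => -[/H ? /H ? /H ? /H ?].
Qed.

Lemma eqc1P m A : (m %| L)%N ->
  reflect (mx_eqmod m A 1%:M) (eqc m L 1 (mx_code L A) (onec L)).
Proof. by move=> mL; have := eqcP 1 A 1%:M mL; rewrite scale1r mx_code1. Qed.

Lemma unitcP (A : 'M[Zhat]_2) :
  reflect (exists u, zeq L (\det A * u) 1) (unitc L (mx_code L A)).
Proof.
have H u : (ent L 0 (mx_code L A) * ent L 3 (mx_code L A) * u ==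
      ent L 1 (mx_code L A) * ent L 2 (mx_code L A) * u + 1 %[mod L])%N
    <-> zeq L (\det A * u%:R) 1.
  rewrite !ent_mx_code.
  rewrite -(zeq_sub0 L _ 1) det_mx2 mulrBl -addrA -opprD zeq_sub0 zeq_mod.
  rewrite zresD // !zresM // zres1 // zres_nat // !modn_mod.
  rewrite !(modnMml, modnMmr, modnDml, modnDmr) -(modnDml (_ %% L * _)) modnMm.
  by rewrite modnDml; split=> /eqP.
apply: (iffP (existsb_ltP _ _)) => [[u _ /H]|[u]]; first by exists u%:R.
move=> uE; exists (zres u L); first exact: zres_lt.
apply/H; apply: zeq_trans uE; apply: zeqM => //.
by apply/zeqE; rewrite zres_nat // modn_small ?zres_lt.
Qed.

Lemma slcP (A : 'M[Zhat]_2) : reflect (zeq L (\det A) 1) (slc L (mx_code L A)).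
Proof.
apply: (iffP idP); rewrite /slc !ent_mx_code.
  move=> /eqP H; apply/zeq_sub0; rewrite det_mx2 -addrA -opprD zeq_sub0 zeq_mod.
  by rewrite zresD // !zresM // zres1 // !modn_mod modnDm H.
move=> /zeq_sub0; rewrite det_mx2 -addrA -opprD zeq_sub0 zeq_mod.
by rewrite zresD // !zresM // zres1 // !modn_mod modnDm => /eqP.
Qed.

Lemma unitc_gl2 (A : GL2Zhat) : unitc L (mx_code L A).
Proof.
by apply/unitcP; exists (\det A)^-1; rewrite mulrV // det_gl2_unit.
Qed.

Lemma unitc_lift x : (x < L ^ 4)%N -> unitc L x ->
  exists A : GL2Zhat, mx_code L A = x.
Proof.
move=> /code_mxK <- /unitcP[u uE]; have [B BE] := lift_GL2 L0 uE.
by exists B; apply/mx_codeP.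
Qed.

Lemma slc_lift x : (x < L ^ 4)%N -> slc L x ->
  exists2 A : GL2Zhat, SL2Zhat A & mx_code L A = x.
Proof.
move=> xL sx; have [|B BE] := unitc_lift xL.
  move: sx; rewrite -(code_mxK xL) => /slcP sx; apply/unitcP.
  by exists 1; rewrite mulr1.
move: sx; rewrite -BE => /slcP /lift_SL2[C SC CB].
by exists C => //; apply/mx_codeP.
Qed.

Definition bit_set s : set GL2Zhat := [set A | bit s (mx_code L A)].

Lemma mulc_gl2 (A B : GL2Zhat) :
  mulc L (mx_code L A) (mx_code L B) = mx_code L (A * B)%g.
Proof. by rewrite mx_codeM. Qed.

Lemma mulc_cancel (A B : GL2Zhat) x : (x < L ^ 4)%N ->
  mulc L (mx_code L A) x = mx_code L B -> x = mx_code L (A^-1 * B)%g.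
Proof.
move=> /code_mxK <-; rewrite -mx_codeM => /mx_codeP H; apply/mx_codeP.
rewrite -[X in mx_eqmod L X _](mul1mx) -mx_of_1 -(mulVg A) !mx_of_mul -mulmxA.
exact: mx_eqmodM.
Qed.

Lemma bit_set_subgroup s : subgroupc L s -> subgroup_set (bit_set s).
Proof.
case/and3P=> s1 /forallb_ltP sM /forallb_ltP sV; split.
- by rewrite /bit_set /= mx_code1.
- move=> A B sA sB; rewrite /bit_set /= -mulc_gl2.
  have /forallb_ltP := sM _ (mx_code_lt A).
  by move=> /(_ _ (mx_code_lt B)); rewrite sA sB.
- move=> A sA; rewrite /bit_set /=.
  have /forallb_ltP := sV _ (mx_code_lt A).
  move=> /(_ _ (mx_code_lt (A^-1)%g)); rewrite sA mulc_gl2 mulgV mx_code1 eqxx.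
  by [].
Qed.

Lemma bit_set_closed s : closed (bit_set s).
Proof.
rewrite -[bit_set s]setCK; apply: open_closedC.
suff : gl2_open (~` bit_set s) by [].
move=> A nA; exists L => // B AB; rewrite /setC /bit_set /=.
by rewrite -((mx_codeP _ _).2 AB).
Qed.

(** [s] codes the image of [H] modulo [L]; [H] need not be a union of residue classes, and higher
    digits of [s] are free. *)
Definition coded (s : nat) (H : set GL2Zhat) : Prop :=
  forall x, (x < L ^ 4)%N -> bit s x <-> exists2 A : GL2Zhat, H A & mx_code L A = x.

Lemma exists_coded H : exists2 s, (s < 2 ^ (L ^ 4))%N & coded s H.
Proof.
have [s sL sP] := exists_bits (L ^ 4)
  (fun x => `[< exists2 A : GL2Zhat, H A & mx_code L A = x >]).
by exists s => // x xL; rewrite sP //; split=> /asboolP.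
Qed.

Lemma coded_subgroupc s H : coded s H -> subgroup_set H -> subgroupc L s.
Proof.
move=> sH [H1 HM HV]; apply/and3P; split.
- by apply/sH; [rewrite -mx_code1; apply: mx_code_lt | exists 1%g; rewrite ?mx_code1].
- apply/forallb_ltP => x xL; apply/forallb_ltP => y yL.
  apply/implyP => /(sH x xL)[A HA <-]; apply/implyP => /(sH y yL)[B HB <-].
  rewrite mulc_gl2; apply/sH; first exact: mx_code_lt.
  by exists (A * B)%g => //; apply: HM.
- apply/forallb_ltP => x xL; apply/forallb_ltP => y yL.
  apply/implyP => /(sH x xL)[A HA <-]; apply/implyP => /eqP.
  rewrite -mx_code1 -mx_of_1 => /(mulc_cancel yL) ->.
  apply/sH; first exact: mx_code_lt.
  by exists (A^-1 * 1)%g => //; rewrite mulg1; apply: HV.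
Qed.
End MatrixCodes.

(** * The closed commutator subgroup and the two levels *)

Lemma has_commutators_closed (G : set GL2Zhat) :
  has_commutators G (closed_commutator G).
Proof. by move=> A B GA GB H [_]; apply; exists A => //; exists B. Qed.

Lemma closed_commutator_sub (G H : set GL2Zhat) : subgroup_set H -> closed H ->
  has_commutators G H -> closed_commutator G `<=` H.
Proof.
by move=> sH cH GH; apply: smallest_sub => // _ [A GA [B GB <-]]; apply: GH.
Qed.

Lemma closed_commutator_subgroup (G : set GL2Zhat) :
  subgroup_set (closed_commutator G).
Proof.
split=> [H [[[H1 _ _] _] _] //|A B cA cB H HH|A cA H HH].
  by have [[[_ HM _] _] _] := HH; apply: HM; [apply: cA | apply: cB].
by have [[[_ _ HV] _] _] := HH; apply: HV; apply: cA.
Qed.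

Lemma commutator_SL2 (A B : GL2Zhat) : SL2Zhat [~ A, B]%g.
Proof.
rewrite /SL2Zhat /=; have uA := det_gl2_unit A; have uB := det_gl2_unit B.
have : \det (mx_of (A * B)%g) = \det (mx_of (B * A * [~ A, B])%g) by rewrite -commgC.
rewrite !mx_of_mul !det_mulmx [\det A * _]mulrC => /esym.
by rewrite -[X in _ = X -> _]mulr1; apply: mulrI; rewrite unitrM uA uB.
Qed.

Lemma SL2_closed : closed SL2Zhat.
Proof.
rewrite -[SL2Zhat]setCK; apply: open_closedC.
suff : gl2_open (~` SL2Zhat) by [].
move=> A nA.
have [n n0 An] : exists2 n, (0 < n)%N & ~ zeq n (\det A) 1.
  apply: contrapT => H; apply: nA; apply: zhat_eqP => n n0.
  by apply: contrapT => An; apply: H; exists n.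
exists n => // B AB SB; apply: An; rewrite -SB.
exact: mx_eqmod_det.
Qed.

Lemma closed_commutator_SL2 G : closed_commutator G `<=` SL2Zhat.
Proof.
apply: closed_commutator_sub; [exact: SL2_subgroup | exact: SL2_closed |].
by move=> A B _ _; apply: commutator_SL2.
Qed.

Definition agreeable_level (G : set GL2Zhat) : nat :=
  lcmn (level setT G) (level SL2Zhat (closed_commutator G)).

Lemma agreeable_levelP n (G : set GL2Zhat) (N := agreeable_level G) :
  (0 < n)%N -> subgroup_set G -> ker_mod n `<=` G ->
  [/\ (0 < N)%N, (N %| 4 * n ^ 4)%N, ker_mod N `<=` G &
      SL2Zhat `&` ker_mod N `<=` closed_commutator G].
Proof.
move=> n0 sG nG; have L0 : (0 < 4 * n ^ 4)%N by rewrite muln_gt0 expn_gt0 n0.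
have nL : (n %| 4 * n ^ 4)%N by apply: dvdn_mull; apply: dvdn_exp.
have [|a0 aK aL] := @level_spec setT G _ (or_introl erefl) sG L0.
  by move=> A [_ KA]; apply: nG; apply: ker_mod_dvd KA.
have [|b0 bK bL] := @level_spec SL2Zhat (closed_commutator G) _
    (or_intror erefl) (closed_commutator_subgroup G) L0.
  apply: (SL2_ker_commutators n0 nG); first exact: closed_commutator_subgroup.
  exact: has_commutators_closed.
have N0 : (0 < N)%N by rewrite lcmn_gt0 a0.
split=> //; first by rewrite dvdn_lcm aL.
  move=> A KA; apply: aK; split=> //.
  by apply: ker_mod_dvd KA => //; apply: dvdn_lcml.
move=> A [SA KA]; apply: bK; split=> //.
by apply: ker_mod_dvd KA => //; apply: dvdn_lcmr.
Qed.

Section Presented.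
Variables (n : nat) (l : seq (nat * nat * nat * nat)) (G : set GL2Zhat).
Hypotheses (sG : subgroup_set G) (PG : presents (n, l) G).

Let L := (4 * n ^ 4)%N.
Let n0 : (0 < n)%N. Proof. by case: PG. Qed.
Let L0 : (0 < L)%N. Proof. by rewrite muln_gt0 expn_gt0 n0. Qed.
Let nL : (n %| L)%N. Proof. by apply: dvdn_mull; apply: dvdn_exp. Qed.

Lemma presents_ker : ker_mod n `<=` G.
Proof.
move=> A KA; have [G1 _ _] := sG; move: G1.
case: PG => _ -> [e el e1]; exists e => //; apply: mx_eqmod_trans e1.
exact: KA.
Qed.

Lemma matchcP (A : 'M[Zhat]_2) :
  reflect (exists2 e, e \in l & mx_eqmod n A (nat_mx e))
          (matchc n (pickle l) L (mx_code L A)).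
Proof.
have H x a : (zres x L == a %[mod n])%N <-> zeq n x a%:R.
  by rewrite zeqE zres_nat // (zres_dvd x L0 nL); split=> /eqP.
have Q a b c d : code_quad a b c d = pickle (a, b, c, d).
  by rewrite !pickle_pairE.
apply: (iffP (existsb_ltP _ _)) => [[a _ /existsb_ltP[b _]]|[[[[a b] c] d] el AE]].
  case/existsb_ltP=> c _ /existsb_ltP[d _ /and5P[]].
  rewrite Q pickle_seqE code_memP mem_map; last exact: (pcan_inj pickleK).
  rewrite !ent_mx_code // => el /H ? /H ? /H ? /H ?.
  by exists (a, b, c, d) => //; rewrite nat_mxE; apply/mx_eqmodP; rewrite !mx2E.
have ml : code_mem (code_quad a b c d) (pickle l).
  rewrite Q pickle_seqE code_memP mem_map //; exact: (pcan_inj pickleK).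
have lt := code_mem_lt ml.
have [lt1 ltd] := code_pair_gt (code_pair (code_pair a b) c) d.
have [lt2 ltc] := code_pair_gt (code_pair a b) c.
have [lta ltb] := code_pair_gt a b.
rewrite -/(code_quad a b c d) in lt1 ltd.
move: AE; rewrite nat_mxE => /mx_eqmodP; rewrite !mx2E => -[/H ? /H ? /H ? /H ?].
have lt3 := ltn_trans lt1 lt; have lt4 := ltn_trans lt2 lt3.
exists a; first exact: ltn_trans lta lt4.
apply/existsb_ltP; exists b; first exact: ltn_trans ltb lt4.
apply/existsb_ltP; exists c; first exact: ltn_trans ltc lt3.
apply/existsb_ltP; exists d; first exact: ltn_trans ltd lt.
by apply/and5P; split=> //; rewrite ent_mx_code.
Qed.

Lemma incP (A : GL2Zhat) : reflect (G A) (inc n (pickle l) L (mx_code L A)).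
Proof.
rewrite /inc unitc_gl2 //=; case: PG => _ ->; exact: matchcP.
Qed.

Lemma inc_lift x : (x < L ^ 4)%N -> inc n (pickle l) L x ->
  exists2 A, G A & mx_code L A = x.
Proof.
move=> xL ix; have [|A AE] := unitc_lift L0 xL; first by case/andP: ix.
by exists A => //; apply/incP; rewrite AE.
Qed.

Lemma bit_set_commutators s :
  commc n (pickle l) L s -> has_commutators G (bit_set L s).
Proof.
move=> /forallb_ltP sC A B GA GB.
have /forallb_ltP /(_ _ (mx_code_lt L0 B)) := sC _ (mx_code_lt L0 A).
move=> /forallb_ltP /(_ _ (mx_code_lt L0 [~ A, B]%g)).
rewrite (introT (incP A) GA) (introT (incP B) GB) !mulc_gl2 // -commgC eqxx.
by [].
Qed.

Lemma coded_commc s H : coded L s H -> has_commutators G H ->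
  commc n (pickle l) L s.
Proof.
move=> sH HC; apply/forallb_ltP => x xL; apply/forallb_ltP => y yL.
apply/forallb_ltP => z zL.
apply/implyP => /(inc_lift xL)[A GA <-]; apply/implyP => /(inc_lift yL)[B GB <-].
rewrite !mulc_gl2 //; apply/implyP => /eqP /(mulc_cancel L0 zL) zE.
apply/(sH z zL); exists [~ A, B]%g; first exact: HC.
by rewrite zE (commgC A B) mulKg.
Qed.

Lemma SL2_ker_sub H : subgroup_set H -> has_commutators G H ->
  SL2Zhat `&` ker_mod L `<=` H.
Proof. exact: (SL2_ker_commutators n0 presents_ker). Qed.

Lemma ker_subcP m : (0 < m)%N -> (m %| L)%N ->
  reflect (ker_mod m `<=` G) (ker_subc n (pickle l) L m).
Proof.
move=> m0 mL; rewrite /ker_subc m0 (eqP mL) /=.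
apply: (iffP (forallb_ltP _ _)) => [H A KA|KG x xL].
  apply/incP; have := H _ (mx_code_lt L0 A); rewrite unitc_gl2 //=.
  by rewrite (introT (eqc1P L0 A mL) KA).
apply/implyP => /(unitc_lift L0 xL)[A <-]; apply/implyP => /(eqc1P L0 _ mL) KA.
by apply/incP/KG.
Qed.

(** A coded subgroup pulls back to a closed subgroup, which gives one direction. Conversely, a
    subgroup with the commutators contains the kernel of SL2 modulo [L], so membership of an element
    of SL2 can be tested on residues. *)
Lemma sker_subcP m : (0 < m)%N -> (m %| L)%N ->
  reflect (SL2Zhat `&` ker_mod m `<=` closed_commutator G)
          (sker_subc n (pickle l) L m).
Proof.
move=> m0 mL; rewrite /sker_subc m0 (eqP mL) /=.
apply: (iffP (forallb_ltP _ _)) => [K A [SA KA] H [[sH cH] HC]|KG s sL].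
  (* Inside SL2, an element of the group congruent to [A] modulo [L] differs from [A] by an element
     of the kernel of SL2. *)
  have {}HC : has_commutators G (H `&` SL2Zhat).
    move=> B C GB GC; split; last exact: commutator_SL2.
    by apply: HC; exists B => //; exists C.
  have {}sH : subgroup_set (H `&` SL2Zhat).
    have [H1 HM HV] := sH; have [S1 SM SV] := SL2_subgroup.
    split=> [//|B C [? ?] [? ?]|B [? ?]]; first by split; [apply: HM | apply: SM].
    by split; [apply: HV | apply: SV].
  have [s sL sE] := exists_coded L (H `&` SL2Zhat).
  have := K s sL; rewrite (coded_subgroupc L0 sE sH) (coded_commc sE HC) /=.
  move=> /forallb_ltP /(_ _ (mx_code_lt L0 A)).
  have -> : slc L (mx_code L A) by apply/slcP; rewrite // SA.
  rewrite (introT (eqc1P L0 A mL) KA) /= => /(sE _ (mx_code_lt L0 A))[B [HB SB]].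
  move=> /(mx_codeP L0) BA.
  have [H1 HM HV] := sH; have [S1 SM SV] := SL2_subgroup.
  suff [] : (H `&` SL2Zhat) A by [].
  have -> : A = (A * B^-1 * B)%g by rewrite mulgKV.
  apply: (HM) => //; apply: (SL2_ker_sub sH HC); split.
    by apply: SM => //; apply: SV.
  by apply/ker_modE; apply: mx_eqmod_sym.
apply/implyP => sS; apply/implyP => sC; apply/forallb_ltP => x xL.
apply/implyP => /(slc_lift L0 xL)[A SA <-]; apply/implyP => /(eqc1P L0 _ mL) KA.
apply: (@closed_commutator_sub G (bit_set L s)) => //.
- exact: bit_set_subgroup.
- exact: bit_set_closed.
- exact: bit_set_commutators.
- exact: KG.
Qed.

Let N := agreeable_level G.

Lemma levelcP m : (levelc n (pickle l) L m) = (m == N).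
Proof.
have [N0 NL NG NC] := agreeable_levelP n0 sG presents_ker.
have K k : ker_subc n (pickle l) L k -> sker_subc n (pickle l) L k -> (N %| k)%N.
  move=> kG kC; have /and3P[k0 kL _] := kG.
  move: kG kC => /(ker_subcP k0 kL) kG /(sker_subcP k0 kL) kC.
  rewrite dvdn_lcm; apply/andP; split.
    have [|_ _ //] := @level_spec setT G k (or_introl erefl) sG k0.
    by move=> A [_]; apply: kG.
  by have [] := @level_spec SL2Zhat (closed_commutator G) k (or_intror erefl)
    (closed_commutator_subgroup G) k0 kC.
have NN : ker_subc n (pickle l) L N && sker_subc n (pickle l) L N.
  by rewrite (introT (ker_subcP N0 NL) NG) (introT (sker_subcP N0 NL) NC).
apply/and3P/eqP => [[mG mC /forallb_ltP mmin]|->].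
  have m0 : (0 < m)%N by case/and3P: mG.
  have Nm := dvdn_leq m0 (K _ mG mC).
  apply/eqP; rewrite eqn_leq Nm andbT leqNgt; apply/negP => /mmin.
  by rewrite NN.
case/andP: (NN) => ? ?; split=> //; apply/forallb_ltP => k kN.
apply/negP => /andP[kG kC]; have k0 : (0 < k)%N by case/and3P: kG.
by have := dvdn_leq k0 (K _ kG kC); rewrite leqNgt kN.
Qed.
End Presented.

(** * Intermediate groups, their lifts and the output of the search *)

Definition between (G W : set GL2Zhat) : Prop :=
  [/\ subgroup_set W, closed_commutator G `<=` W & W `<=` G `&` SL2Zhat].

Definition lifts (G : set GL2Zhat) : set (set GL2Zhat) :=
  [set lift_subgroup (agreeable_level G) W | W in between G].

(** Any number decodes to a list of numbers; a solution of the formula is a typed list only once its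
    items are known to be pickles. *)
Lemma map_pickle_ex (T : countType) (t : seq nat) :
  (forall z, z \in t -> exists e : T, z = pickle e) ->
  exists s : seq T, t = map pickle s.
Proof.
elim: t => [|z t IH] H; first by exists [::].
have [e ->] := H z (mem_head z t).
have [|s ->] := IH; last by exists (e :: s).
by move=> w wt; apply: H; rewrite in_cons wt orbT.
Qed.

Lemma code_entE L x :
  code_ent L x = pickle (ent L 0 x, ent L 1 x, ent L 2 x, ent L 3 x).
Proof. by rewrite !pickle_pairE. Qed.

Section LiftCodes.
Variables (L N : nat).
Hypotheses (L0 : (0 < L)%N) (NL : (N %| L)%N).

Lemma liftcP s W (A : GL2Zhat) : coded L s W ->
  reflect (lift_subgroup N W A) (liftc L N s (mx_code L A)).
Proof.
move=> sW; rewrite /liftc unitc_gl2 //=.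
apply: (iffP (existsb_ltP _ _)) => [[y yL /andP[/(sW y yL)[B WB <-]]]|].
  case/existsb_ltP => v vL /andP[/existsb_ltP[u uL /eqP vu]].
  move=> /(eqcP L0 _ _ _ NL) AE.
  have co : coprime v L.
    have := coprime1n L; rewrite -coprime_modl -vu coprime_modl coprimeMl.
    by case/andP.
  have [w uw wv] := lift_unit L0 co; exists B, w; split=> //.
  apply: mx_eqmod_trans AE _; apply: mx_eqmodZ => //.
  by rewrite natrX; apply: zeqX; apply: zeq_sym; apply: zeq_dvd wv.
case=> B [v [WB uv AE]]; exists (mx_code L B); first exact: mx_code_lt.
apply/andP; split; first by apply/(sW _ (mx_code_lt L0 B)); exists B.
apply/existsb_ltP; exists (zres v L); first exact: zres_lt.
apply/andP; split.
  apply/existsb_ltP; exists (zres v^-1 L); first exact: zres_lt.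
  by rewrite -zresM // mulrV // zres1.
apply/(eqcP L0 _ _ _ NL); apply: mx_eqmod_trans AE _; apply: mx_eqmodZ => //.
rewrite natrX; apply: zeqX; apply: (zeq_dvd L0 NL); apply/zeqE.
by rewrite zres_nat // modn_small ?zres_lt.
Qed.

Lemma presc_presents s W q : coded L s W -> presc L N q s ->
  exists2 P : presentation, q = pickle P & presents P (lift_subgroup N W).
Proof.
move=> sW /existsb_ltP[g _ /and3P[/eqP -> /forallb_ltP gl /forallb_ltP lg]].
have gm z : (z \in CodeSeq.decode g) = code_mem z g.
  by rewrite -{2}[g]CodeSeq.decodeK code_memP.
have {}gl z : z \in CodeSeq.decode g -> exists x,
    [/\ (x < L ^ 4)%N, z = code_ent L x & liftc L N s x].
  rewrite gm => zg; have := gl z (code_mem_lt zg); rewrite zg.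
  by case/existsb_ltP=> x xL /andP[/eqP zx lx]; exists x.
have [|t tE] := @map_pickle_ex (nat * nat * nat * nat)%type (CodeSeq.decode g).
  by move=> z /gl[x [_ -> _]]; rewrite code_entE; eexists.
have pickle_inj : injective (@pickle (nat * nat * nat * nat)%type).
  exact: (pcan_inj pickleK).
exists (L, t).
  by rewrite [RHS]pickle_pairE pickle_seqE -tE CodeSeq.decodeK.
split=> //; apply/seteqP; split=> A /=.
  move=> /(liftcP A sW) lA; have := lg _ (mx_code_lt L0 A); rewrite lA /=.
  rewrite -gm tE code_entE mem_map // => et.
  eexists; first exact: et.
  rewrite nat_mxE -/(code_mx L _); apply/(mx_codeP L0).
  by rewrite code_mxK // mx_code_lt.
case=> e et /(mx_codeP L0) AE; apply/(liftcP A sW); rewrite AE.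
have /gl[x [xL ex lx]] : pickle e \in CodeSeq.decode g by rewrite tE map_f.
move: ex; rewrite code_entE => /pickle_inj ->.
by rewrite nat_mxE -/(code_mx L _) code_mxK.
Qed.

Lemma presc_exists s : exists P : presentation, presc L N (pickle P) s.
Proof.
pose t := [seq (ent L 0 x, ent L 1 x, ent L 2 x, ent L 3 x) |
           x <- iota 0 (L ^ 4) & liftc L N s x].
exists (L, t); have E : pickle (L, t) = code_pair L (pickle t) by apply: pickle_pairE.
apply/existsb_ltP; exists (pickle t).
  by rewrite E; case: (code_pair_gt L (pickle t)).
rewrite E eqxx /=; apply/andP; split.
  apply/forallb_ltP => z _; apply/implyP; rewrite pickle_seqE code_memP.
  case/mapP=> e /mapP[x]; rewrite mem_filter mem_iota => /andP[lx xL] -> ->.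
  by apply/existsb_ltP; exists x => //; rewrite lx -code_entE eqxx.
apply/forallb_ltP => x xL; apply/implyP => lx.
rewrite pickle_seqE code_memP code_entE map_f //; apply/mapP; exists x => //.
by rewrite mem_filter mem_iota lx.
Qed.
End LiftCodes.

Section Presented.
Variables (n : nat) (l : seq (nat * nat * nat * nat)) (G : set GL2Zhat).
Hypotheses (sG : subgroup_set G) (PG : presents (n, l) G).

Let L := (4 * n ^ 4)%N.
Let n0 : (0 < n)%N. Proof. by case: PG. Qed.
Let L0 : (0 < L)%N. Proof. by rewrite muln_gt0 expn_gt0 n0. Qed.
Let N := agreeable_level G.
Let NL : (N %| L)%N.
Proof. by have [] := agreeable_levelP n0 sG (presents_ker sG PG). Qed.

(** Intersecting the preimage of [s] with SL2 loses no residue, since every code satisfying [slc]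
    lifts to SL2. *)
Lemma interc_between s : interc n (pickle l) L s ->
  exists2 W, between G W & coded L s W.
Proof.
case/and3P=> sS sC /forallb_ltP sI.
have sH := bit_set_subgroup L0 sS; have HC := bit_set_commutators PG sC.
exists (bit_set L s `&` SL2Zhat).
  split.
  - have [H1 HM HV] := sH; have [S1 SM SV] := SL2_subgroup.
    split=> [//|B C [? ?] [? ?]|B [? ?]]; first by split; [apply: HM | apply: SM].
    by split; [apply: HV | apply: SV].
  - rewrite subsetI; split; last exact: closed_commutator_SL2.
    by apply: closed_commutator_sub => //; apply: bit_set_closed.
  - move=> A [sA SA]; split=> //; have := sI _ (mx_code_lt L0 A).
    by rewrite (sA : is_true _) /= => /andP[/(incP PG)].
move=> x xL; split=> [sx|[A [sA _] <- //]].
have := sI x xL; rewrite sx /= => /andP[_ /(slc_lift L0 xL)[A SA AE]].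
by exists A => //; split=> //; rewrite /bit_set /= AE.
Qed.

Lemma between_interc W s : between G W -> coded L s W ->
  interc n (pickle l) L s.
Proof.
move=> [sW CW WG] cs; apply/and3P; split.
- exact: (coded_subgroupc L0 cs).
- apply: (coded_commc PG cs) => A B GA GB; apply: CW.
  exact: has_commutators_closed.
- apply/forallb_ltP => x xL; apply/implyP => /(cs x xL)[A /WG[GA SA] <-].
  apply/andP; split; first exact/(incP PG).
  by apply/slcP; rewrite // SA.
Qed.

(** Correctness is needed for every solution, since the search returns the least one and not a list
    chosen in advance. *)
Lemma outc_presents y : outc n (pickle l) L N y ->
  exists2 Q : seq presentation, y = pickle Q & presents_all Q (lifts G).
Proof.
case/andP=> /forallb_ltP yq /forallb_ltP yW.
have gm z : (z \in CodeSeq.decode y) = code_mem z y.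
  by rewrite -{2}[y]CodeSeq.decodeK code_memP.
have {}yq z : z \in CodeSeq.decode y -> exists2 P : presentation, z = pickle P &
    exists2 H, lifts G H & presents P H.
  rewrite gm => zy; have := yq z (code_mem_lt zy); rewrite zy /=.
  case/existsb_ltP=> s sL /andP[/interc_between[W bW cs]].
  case/(presc_presents L0 NL cs)=> P -> PW; exists P => //.
  by exists (lift_subgroup N W) => //; exists W.
have [|Q QE] := @map_pickle_ex presentation (CodeSeq.decode y).
  by move=> z /yq[P -> _]; exists P.
exists Q; first by rewrite [RHS]pickle_seqE -QE CodeSeq.decodeK.
split=> [P PQ|_ [W bW <-]].
  have /yq[P' /(pcan_inj pickleK) ->] : pickle P \in CodeSeq.decode y.
    by rewrite QE map_f.
  by [].
have [s sL cs] := exists_coded L W.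
have := yW s sL; rewrite (between_interc bW cs) /= => /existsb_ltP[q _ /andP[]].
rewrite -gm QE => /mapP[P PQ ->] /(presc_presents L0 NL cs)[P'].
by move=> /(pcan_inj pickleK) <- PW; exists P.
Qed.

Lemma outc_exists : exists Q : seq presentation, outc n (pickle l) L N (pickle Q).
Proof.
have [P PE] := choice (presc_exists L N).
exists [seq P s | s <- iota 0 (2 ^ (L ^ 4)) & interc n (pickle l) L s].
have lt := @code_mem_lt; set Q := map _ _.
apply/andP; split; apply/forallb_ltP.
  move=> q _; apply/implyP; rewrite pickle_seqE code_memP.
  case/mapP=> p /mapP[s]; rewrite mem_filter mem_iota => /andP[si sL] -> ->.
  by apply/existsb_ltP; exists s => //; rewrite si PE.
move=> s sL; apply/implyP => si.
have Pm : code_mem (pickle (P s)) (pickle Q).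
  rewrite pickle_seqE code_memP map_f //; apply/mapP; exists s => //.
  by rewrite mem_filter mem_iota si.
by apply/existsb_ltP; exists (pickle (P s)); rewrite ?lt // Pm PE.
Qed.
End Presented.

Lemma solc_presents (P : presentation) G y : subgroup_set G -> presents P G ->
  solc (pickle P) y ->
  exists2 Q : seq presentation, y = pickle Q & presents_all Q (lifts G).
Proof.
case: P => n l sG PG /existsb_ltP[m _ /existsb_ltP[k _ /andP[]]].
rewrite pickle_pairE => /eqP /code_pair_inj[<- <-] /existsb_ltP[N _ /andP[]].
by rewrite (levelcP sG PG) => /eqP -> /(outc_presents sG PG).
Qed.

Lemma solc_exists (P : presentation) G : subgroup_set G -> presents P G ->
  exists y, solc (pickle P) y.
Proof.
case: P => n l sG PG; have [Q QE] := @outc_exists n l G.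
exists (pickle Q); have [nlt llt] := code_pair_gt n (pickle l).
apply/existsb_ltP; rewrite pickle_pairE; exists n => //.
apply/existsb_ltP; exists (pickle l) => //; rewrite eqxx /=.
have [n0 _] := PG.
have [N0 NL _ _] := agreeable_levelP n0 sG (presents_ker sG PG).
apply/existsb_ltP; exists (agreeable_level G).
  by rewrite ltnS dvdn_leq // muln_gt0 expn_gt0 [X in X || _]n0.
by rewrite (levelcP sG PG) eqxx.
Qed.

Lemma recursive_lifts : exists f : recfun 1,
  forall G (P : presentation), subgroup_set G -> presents P G ->
  exists2 Q : seq presentation, computes_on f P Q & presents_all Q (lifts G).
Proof.
have : recursive 2 (fun w => nat_of_bool (~~ solc (nth 0 w 1) (nth 0 w 0))%N).
  apply: recursive_neg.
  apply: (@recursive_comp2 _ (fun a b => nat_of_bool (solc a b)) _ _ recursive_solc);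
    exact: recursive_proj.
(* The function is fixed before the group, which enters only through the presentation. *)
case=> g gE; exists (RecMin g) => G P sG PG.
have ex := solc_exists sG PG.
have [y ys ymin] := ex_minnP ex.
have [Q yQ PQ] := solc_presents sG PG ys; exists Q => //.
rewrite /computes_on -yQ; split=> [|k ky].
  by have := gE [:: y; pickle P] erefl; rewrite /= ys.
exists 0%N; have := gE [:: k; pickle P] erefl => /=.
by case: (boolP (solc _ _)) => // /ymin; rewrite leqNgt ky.
Qed.

(** * Index of the determinants, finiteness and conclusion *)

Lemma lift_subgroup_index N W : (0 < N)%N -> subgroup_set W ->
  exists k, (unit_cosets (det_image (lift_subgroup N W)) #= `I_(2 ^ k)%N)%card.
Proof.
move=> N0 sW; have [G1 GM _] := lift_subgroup_subgroup N sW.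
(* The exponent is [N.+1] because a scalar [x ^+ (2 ^ N)] has its square as determinant. *)
apply: (@unit_cosets_pow2 _ N N.+1) => //.
- by exists 1%g; rewrite // mx_of_1 det1.
- move=> _ _ [A GA <-] [B GB <-]; exists (A * B)%g; first exact: GM.
  by rewrite mx_of_mul det_mulmx.
- by move=> _ [A _ <-]; apply: det_gl2_unit.
- move=> x ux x1; have [|A AE] := @exists_gl2 (mx2 x 0 0 1).
    by rewrite det_mx2 !mx2E mulr1 mul0r subr0.
  exists A; last by rewrite AE det_mx2 !mx2E mulr1 mul0r subr0.
  apply: lift_subgroup_ker => //; rewrite /ker_mod /= AE mx2_1.
  by apply/mx_eqmodP; rewrite !mx2E.
- move=> x ux; have [|A AE] := @exists_scalar (x ^+ (2 ^ N)); first by rewrite unitrX.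
  exists A; last by rewrite AE det_scalar -exprM expnSr.
  by exists 1%g, x; split=> //; [case: sW | rewrite AE mx_of_1 scalemx1].
Qed.

(** A group containing the kernel of SL2 modulo [N] is recovered from its residues, which bounds the
    number of intermediate groups. *)
Lemma coded_SL2 N s W : (0 < N)%N -> subgroup_set W -> W `<=` SL2Zhat ->
  SL2Zhat `&` ker_mod N `<=` W -> coded N s W -> W = bit_set N s `&` SL2Zhat.
Proof.
move=> N0 [_ WM _] WS KW cs; apply/seteqP; split=> [A WA|A [sA SA]].
  split; last exact: WS.
  by apply/(cs _ (mx_code_lt N0 A)); exists A.
have /(cs _ (mx_code_lt N0 A))[B WB /(mx_codeP N0) BA] := sA.
have -> : A = (A * B^-1 * B)%g by rewrite mulgKV.
apply: (WM) => //; apply: KW; split; last exact/ker_modE/mx_eqmod_sym.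
by have [_ SM SV] := SL2_subgroup; apply: SM => //; apply/SV/WS.
Qed.

Theorem theorem2p8 :
  exists f : recfun 1,
  forall GG : set GL2Zhat, agreeable GG ->
  let GG' := closed_commutator GG in
  let N := lcmn (level setT GG) (level SL2Zhat GG') in
  exists SGG : set (set GL2Zhat),
    [/\ finite_set SGG /\
          (forall P : presentation, presents P GG ->
             exists2 Q : seq presentation,
               computes_on f P Q & presents_all Q SGG),
        forall G, SGG G -> [/\ subgroup_set G, open G & G `<=` GG] &
    [/\ forall G, SGG G ->
          GG' `<=` G `&` SL2Zhat /\ G `&` SL2Zhat `<=` GG `&` SL2Zhat,
        forall G, SGG G -> exists k : nat, (level setT G %| 2 ^ k * N)%N,
        forall G, SGG G ->
          exists k : nat, (unit_cosets (det_image G) #= `I_(2 ^ k)%N)%card &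
        forall W : set GL2Zhat, subgroup_set W ->
          GG' `<=` W -> W `<=` GG `&` SL2Zhat ->
          exists! G : set GL2Zhat, SGG G /\ G `&` SL2Zhat = W]].
Proof.
have [f fE] := recursive_lifts; exists f => GG [sG oG scal _] GG' N.
have [n n0 nG] := open_ker sG oG.
have [N0 _ NG NC] := agreeable_levelP n0 sG nG.
rewrite -/N -/GG' in N0 NG NC.
have SW W : GG' `<=` W -> W `<=` GG `&` SL2Zhat -> subgroup_set W ->
    lift_subgroup N W `&` SL2Zhat = W.
  move=> CW WG sW; apply: lift_subgroup_SL2 => //.
    by move=> A /WG[].
  by move=> A /NC; apply: CW.
exists (lifts GG); split; [split|..|split].
(* Finiteness: each lift comes from a code below [2 ^ (N ^ 4)]. *)
- pose lift_bits s := lift_subgroup N (bit_set N s `&` SL2Zhat).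
  apply: (@sub_finite_set _ _ (lift_bits @` `I_(2 ^ (N ^ 4)))).
    move=> _ [W [sW CW WG] <-]; have [s sL cs] := exists_coded N W.
    exists s; rewrite /lift_bits -?(@coded_SL2 N s W) //; first by move=> A /WG[].
    by move=> A /NC; apply: CW.
  exact/finite_image/finite_II.
- by move=> P PG; apply: fE.
- move=> _ [W [sW CW WG] <-]; split.
  + exact: lift_subgroup_subgroup.
  + apply: (open_subgroup N0); first exact: lift_subgroup_subgroup.
    exact: lift_subgroup_ker.
  + by apply: lift_subgroup_sub => // A /WG[].
- by move=> _ [W [sW CW WG] <-]; rewrite SW.
(* The lift contains the whole kernel modulo [N], so no extra power of 2 appears in its level. *)
- move=> _ [W [sW CW WG] <-]; exists 0%N; rewrite mul1n.
  have [] // := @level_spec setT (lift_subgroup N W) N (or_introl erefl).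
    exact: lift_subgroup_subgroup.
  by move=> A [_]; apply: lift_subgroup_ker.
- by move=> _ [W [sW _ _] <-]; apply: lift_subgroup_index.
- move=> W sW CW WG; exists (lift_subgroup N W); split.
    by split; [exists W | apply: SW].
  (* Uniqueness: the determinant-one part of the lift of [W'] is [W'], so the lift determines the
     group it comes from. *)
  by move=> _ [[W' [sW' CW' WG'] <-]]; rewrite SW // => ->.
Qed.
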